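(* Let $r\in\mathbb{N}$ and $1\le p<\infty$. There exist constants $c,C>0$ (depending only on $r$ and $p$) such that for every integer $n\ge 1$ and every $v\in(0,1]$ with $v\ge c/b_n$ we have $$ \tilde D^{r}_p(\mathcal{F}_n,v) \,\le\, C\,\frac{\sqrt{\log(b_n v)}}{b_n^r}, $$ where $b_n$ is the $n$th Fibonacci number, $\mathcal{F}_n\subset[0,1)^2$ is the $n$th Fibonacci point set, and $\tilde D^r_p(\mathcal{F}_n,v)$ is its periodic $r$-smooth fixed volume $L_p$-discrepancy (in dimension $d=2$).
   Context: Here $\mathbb{N}=\{1,2,3,\dots\}$. Fibonacci point set: let $b_0=b_1=1$ and $b_n=b_{n-1}+b_{n-2}$ for $n\ge 2$. For $n\ge 1$, $$ \mathcal{F}_n:=\Big\{\big(\mu/b_n,\{\mu b_{n-1}/b_n\}\big)\colon \mu=1,\dots,b_n\Big\}, $$ where $\{a\}$ is the fractional part of $a$ (and $\mu/b_n=1$ for $\mu=b_n$ is identified with $0$ by periodicity). It has $b_n$ elements. Univariate functions: for $u>0$ let $h^1_u(x):=\chi_{[-u/2,u/2)}(x)$ be the characteristic function of $[-u/2,u/2)$ on $\mathbb{R}$, and for $r\ge 2$ define inductively $h^r_u:=h^{r-1}_u\ast h^1_u$, where $(f\ast g)(x):=\int_{\mathbb{R}}f(x-y)g(y)\,dy$. Boxes: all boxes are $B=\prod_{j=1}^d[z_j-ru_j/2,\,z_j+ru_j/2)$ with $u_j>0$, and $\mathrm{vol}(B)=r^d\prod_{j=1}^d u_j$ is the volume of $B$.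 For such $B$ set $h^r_B(\mathbf{x}):=\prod_{j=1}^d h^r_{u_j}(x_j-z_j)$, $\mathbf{x}\in\mathbb{R}^d$, and let $\tilde h^r_B(\mathbf{x}):=\sum_{\mathbf{m}\in\mathbb{Z}^d}h^r_B(\mathbf{m}+\mathbf{x})$ be its periodization (period $1$ in each variable). Periodic $r$-smooth fixed volume $L_p$-discrepancy: let $\Omega_d:=[0,1)^d$. For $r\in\mathbb{N}$, $1\le p\le\infty$, $v\in(0,1]$ and a point set $\xi=\{\xi^\mu\}_{\mu=1}^m\subset\Omega_d$, $$ \tilde D^{r}_p(\xi,v):=\sup_{B\subset\Omega_d:\,\mathrm{vol}(B)=v}\left\|\int_{\Omega_d}\tilde h^r_B(\mathbf{x}-\mathbf{z})\,d\mathbf{x}-\frac1m\sum_{\mu=1}^m\tilde h^r_B(\xi^\mu-\mathbf{z})\right\|_p, $$ where the supremum is over boxes $B$ of the form $\prod_{j=1}^d[a_j-ru_j/2,\,a_j+ru_j/2)$ with $a_j\in\mathbb{R}$ and $u_j>0$ contained in $\Omega_d$ with volume $v$, and the $L_p$-norm is taken with respect to $\mathbf{z}$ over $\Omega_d$. In the claim $d=2$. *)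

(* Defs.v *)
From HB Require Import structures.
From mathcomp Require Import all_boot all_order all_algebra.
From mathcomp Require Import all_classical all_reals all_analysis.
Set Implicit Arguments.
Unset Strict Implicit.
Unset Printing Implicit Defensive.
Import Order.TTheory GRing.Theory Num.Theory.
Import numFieldNormedType.Exports.
Local Open Scope classical_set_scope.
Local Open Scope ring_scope.

(* b_0 = b_1 = 1, i.e. shifted by one from the usual F_0 = 0, F_1 = 1. *)
Fixpoint fibn (n : nat) : nat :=
  match n with
  | 0 => 1
  | n'.+1 => if n' is n''.+1 then (fibn n' + fibn n'')%N else 1
  end.

Section Discrepancy.
Context {R : realType}.

Definition fracpart (a : R) : R := a - (Num.floor a)%:~R.

(* The index i : 'I_(fibn n) stands for mu = i + 1 in {1, ..., b_n}; the
   fractional part in the first coordinate sends mu / b_n = 1 to 0 and leaves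
   the other values unchanged. *)
Definition fibonacci_set (n : nat) (i : 'I_(fibn n)) : R * R :=
  (fracpart (i.+1%:R / (fibn n)%:R),
   fracpart (i.+1%:R * (fibn n.-1)%:R / (fibn n)%:R)).

Definition lebesgue2 := ((@lebesgue_measure R) \x (@lebesgue_measure R))%E.

Definition Omega2 : set (R * R) := `[0%R, 1%R[ `*` `[0%R, 1%R[.

Definition convolution (f g : R -> R) (x : R) : R :=
  \int[lebesgue_measure]_(y in setT) (f (x - y) * g y).

(* Meaningful for r >= 1 only: h^1_u = chi_[-u/2, u/2), and
   h^(r+1)_u = h^r_u * h^1_u. *)
Definition hfun (r : nat) (u : R) : R -> R :=
  let chi : R -> R := \1_(`[- (u / 2), u / 2[) in
  iter r.-1 (fun f => convolution f chi) chi.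

(* A box is given by its center z and its scale u : its j-th side is
   [z_j - r u_j / 2, z_j + r u_j / 2). *)
Definition box (r : nat) (z u : R * R) : set (R * R) :=
  `[z.1 - r%:R * u.1 / 2, z.1 + r%:R * u.1 / 2[ `*`
  `[z.2 - r%:R * u.2 / 2, z.2 + r%:R * u.2 / 2[.

Definition box_vol (r : nat) (u : R * R) : R := r%:R ^+ 2 * (u.1 * u.2).

Definition hbox (r : nat) (z u : R * R) (x : R * R) : R :=
  hfun r u.1 (x.1 - z.1) * hfun r u.2 (x.2 - z.2).

(* The summands are nonnegative, so the sum over Z^2 is taken in \bar R; only
   finitely many of them are nonzero, so fine loses nothing. *)
Definition periodized_hbox (r : nat) (z u : R * R) (x : R * R) : R :=
  fine (\esum_(m in [set: int * int])
    (hbox r z u (m.1%:~R + x.1, m.2%:~R + x.2))%:E)%E.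

Definition smooth_error (r m : nat) (xi : 'I_m -> R * R) (a u : R * R)
    (z : R * R) : R :=
  (\int[lebesgue2]_(x in Omega2) periodized_hbox r a u (x.1 - z.1, x.2 - z.2))
  - m%:R^-1 *
    \sum_(i < m) periodized_hbox r a u ((xi i).1 - z.1, (xi i).2 - z.2).

(* The L_p norm over Omega2 is that of the extension by 0 outside Omega2. *)
Definition periodic_discrepancy (r : nat) (p : \bar R) (m : nat)
    (xi : 'I_m -> R * R) (v : R) : \bar R :=
  ereal_sup
    [set D | exists a u : R * R,
      [/\ 0 < u.1, 0 < u.2, box r a u `<=` Omega2, box_vol r u = v
        & D = 'N[lebesgue2]_p[(EFin \o smooth_error r xi a u) \_ Omega2]%E]].

End Discrepancy.

Arguments fibonacci_set R n i : clear implicits.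

(* Main.v *)
(** Write N = b_n, b = b_(n-1), and let ||k|| be the distance from k to N Z.
    The mean of a power of the error over z is the mean over t of its mean over
    the translates t + m / N of the first coordinate.  Along such a progression
    the error is, up to O(N^-r), a trigonometric sum over Z/N with frequencies
    b k (k <> 0), whose coefficients are products of the discrete Fourier
    coefficients at b k and k of two sampled periodic splines.  These decay like
    min(u_1, 1/||b k||)^r and min(u_2, 1/||k||)^r, while ||k|| ||b k|| >= N / 3.

    Split the frequencies into blocks according to the sizes of ||b k|| and of
    ||k|| ||b k|| / N.  By pigeonhole a block has few elements, which bounds its
    L_p norm, p an even integer.  For a fixed size of ||k|| ||b k|| / N the
    blocks are lacunary, so that their norms add up in squares as for martingale
    differences; the cutoffs 1/u_1 and 1/u_2 leave O(log (N u_1 u_2)) of them,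
    hence the square root of the logarithm.  The remaining sum, over the sizes of
    ||k|| ||b k|| / N, is geometric. *)

Require Import Defs.
From HB Require Import structures.
From mathcomp Require Import all_boot all_order all_algebra.
From mathcomp Require Import all_classical all_reals all_analysis.
From mathcomp Require Import measurable_realfun complex.
From mathcomp Require Import ring lra zify.
Set Implicit Arguments.
Unset Strict Implicit.
Unset Printing Implicit Defensive.
Import Order.TTheory GRing.Theory Num.Theory.
Import numFieldNormedType.Exports.
Local Open Scope ring_scope.

(** * The lattice of the Fibonacci point set *)

(** Finite Fourier sums, taken for each fixed t and second coordinate, keep the argument algebraic:
    no Fourier series has to converge, since aliasing is contained in the discrete coefficients. All
    that is needed of the splines is their mean and l1 bounds for their samples and for the r-th
    differences of these, uniformly in the shift. They come from a closed formula for the periodized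
    spline as a difference of a periodic Bernoulli polynomial. As min(u_1, 1/||b k||) min(u_2,
    1/||k||) <= 3/N, all but one of the r powers of this product yield N^-(r-1) at once, and the
    trigonometric sum is treated as for r = 1. The obstacle is p > 2, where Parseval alone does not
    suffice. Rounding p up to an even 2q+2 makes every power of a trigonometric polynomial again one
    of controlled bandwidth, so that the correlations needed vanish exactly and not just
    approximately. *)

(* Distance from k to the nearest multiple of N. *)
Definition idist (N : nat) (k : int) : nat :=
  let r := `|(k %% N)%Z|%N in minn r (N - r).

Lemma idistP (N : nat) (k : int) : (0 < N)%N ->
  exists2 y : int, (N %| k - y)%Z & `|y|%N = idist N k.
Proof.
move=> N0; rewrite /idist.
have hr := modz_ge0 k (_ : (N : int) != 0); have hl := ltz_pmod k (_ : 0 < (N : int)).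
have {}hr : 0 <= (k %% N)%Z by apply: hr; lia.
have {}hl : (k %% N)%Z < N by apply: hl; lia.
have hk : k = (k %/ N)%Z * N + (k %% N)%Z by apply: divz_eq.
set rr := (k %% N)%Z in hr hl hk *; set q := (k %/ N)%Z in hk.
case: (leqP `|rr| (N - `|rr|)) => h.
  exists rr => //; apply/dvdzP; exists q; lia.
exists (rr - Posz N); last by lia.
by apply/dvdzP; exists (q + 1); lia.
Qed.

Lemma idist_le (N : nat) (k y : int) : (0 < N)%N ->
  (N %| k - y)%Z -> (idist N k <= `|y|)%N.
Proof.
move=> N0 /dvdzP[q hq]; rewrite /idist.
have -> : k = q * N + y by lia.
rewrite modzMDl.
have hr : 0 <= (y %% N)%Z by apply: modz_ge0; lia.
have hl : (y %% N)%Z < N by apply: ltz_pmod; lia.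
have hk : y = (y %/ N)%Z * N + (y %% N)%Z by apply: divz_eq.
set rr := (y %% N)%Z in hr hl hk *; set q' := (y %/ N)%Z in hk.
have [q0|q0] := lerP 0 q'.
  rewrite geq_min; apply/orP; left; nia.
rewrite geq_min; apply/orP; right; nia.
Qed.

Lemma idistN (N : nat) (k : int) : (0 < N)%N -> idist N (- k) = idist N k.
Proof.
move=> N0.
have le l : (idist N (- l) <= idist N l)%N.
  have [y /dvdzP[q hq] <-] := idistP l N0.
  rewrite -[`|y|%N]abszN; apply: idist_le => //; apply/dvdzP; exists (- q); lia.
by apply/eqP; rewrite eqn_leq le -{1}(opprK k) le.
Qed.

Lemma idistD (N : nat) (k l : int) : (0 < N)%N ->
  (idist N (k + l) <= idist N k + idist N l)%N.
Proof.
move=> N0; have [y /dvdzP[q hq] <-] := idistP k N0.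
have [z /dvdzP[q' hq'] <-] := idistP l N0.
apply: (@leq_trans `|(y + z)%R|); last by lia.
by apply: idist_le => //; apply/dvdzP; exists (q + q'); lia.
Qed.

Lemma idist_eq0 (N : nat) (k : int) : (0 < N)%N ->
  (idist N k == 0)%N = (N %| k)%Z.
Proof.
move=> N0; apply/idP/idP => [/eqP h|h].
  have [y hy] := idistP k N0; rewrite h => /eqP; rewrite absz_eq0 => /eqP y0.
  by rewrite y0 subr0 in hy.
by rewrite -leqn0 -(absz0); apply: idist_le => //; rewrite subr0.
Qed.

Lemma idist_bound (N : nat) (k : int) : (0 < N)%N -> (2 * idist N k <= N)%N.
Proof.
move=> N0; rewrite /idist.
have hl : (k %% N)%Z < N by apply: ltz_pmod; lia.
have hr : 0 <= (k %% N)%Z by apply: modz_ge0; lia.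
lia.
Qed.

(* fibz is the usual Fibonacci sequence, so that fibn n = fibz n.+1. *)
Definition fibz (n : nat) : nat := if n is n'.+1 then fibn n' else 0%N.

Lemma fibzS (n : nat) : fibz n.+2 = (fibz n.+1 + fibz n)%N.
Proof. by case: n. Qed.

Lemma fibz_gt0 (n : nat) : (0 < fibz n.+1)%N.
Proof. by elim: n => // n IH; rewrite fibzS addn_gt0 IH. Qed.

Lemma fibn_gt0 (n : nat) : (0 < fibn n)%N. Proof. exact: (fibz_gt0 n). Qed.

Lemma fibz_le (n : nat) : (fibz n <= fibz n.+1)%N.
Proof. by case: n => // n; rewrite fibzS leq_addr. Qed.

Lemma fibzD (m n : nat) :
  fibz (m + n).+1 = (fibz m.+1 * fibz n.+1 + fibz m * fibz n)%N.
Proof.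
elim: m n => [|m IH] n; first by rewrite add0n /= mul1n mul0n addn0.
rewrite addSnnS IH !fibzS; nia.
Qed.

Lemma fibz_bracket (n x : nat) : (0 < x < fibz n.+1)%N ->
  exists2 i, (i < n)%N & (fibz i.+1 <= x < fibz i.+2)%N.
Proof.
elim: n => [|n IH]; first by case: x.
move=> /andP[x0 hx]; case: (ltnP x (fibz n.+1)) => h.
  by have [|i hi hi'] := IH; [rewrite x0 | exists i => //; lia].
by exists n => //; rewrite h.
Qed.

(* The lattice generated by (1, b_(n-1)) and (0, b_n) has, for every i < n, the
   basis formed by (F_(i+1), e F_(n-i)) and (F_(i+2), -e F_(n-i-1)), e = +-1. *)
Lemma fib_lattice_basis (n i : nat) (x y : int) : (i < n)%N ->
  (fibz n.+1 %| (fibz n)%:Z * x - y)%Z ->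
  exists a b : int, exists2 e : int, e = 1 \/ e = -1 &
    x = a * fibz i.+1 + b * fibz i.+2 /\
    y = e * (a * fibz (n - i) - b * fibz (n - i).-1).
Proof.
move=> + /dvdzP[q hq]; elim: i => [|i IH] hi.
  exists (x - q), q, 1; first by left.
  rewrite subn0; split; first by rewrite /= !mulr1; ring.
  case: n hi hq => // n _; rewrite fibzS /= => hq; lia.
have {IH}[a [b [e he [hx hy]]]] := IH (ltnW hi).
exists (b - a), a, (- e); first by case: he => ->; [right | left]; rewrite ?opprK.
split; first by rewrite hx (fibzS i.+1); lia.
rewrite hy; case: n hi {hq hy} => // n hi.
have -> : (n.+1 - i = (n.+1 - i.+1).+1)%N by lia.
case E : (n.+1 - i.+1)%N => [|k]; first by lia.
rewrite fibzS /=; lia.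
Qed.

(* Coefficients of the same sign would make |aP + bQ| at least Q, hence there is
   no cancellation in aA - bB. *)
Lemma lattice_coords_bound (a b : int) (A B P Q : nat) : (0 < P)%N ->
  (P <= `|(a * P%:Z + b * Q%:Z)%R| < Q)%N -> (A <= `|(a * A%:Z - b * B%:Z)%R|)%N.
Proof.
move=> P0 /andP[h1 h2].
case: a h1 h2 => [[|m]|m]; case: b => [[|l]|l] h1 h2; rewrite ?NegzE in h1 h2 *;
  try have ? := leq_pmull P (ltn0Sn m); try have ? := leq_pmull Q (ltn0Sn l);
  try have ? := leq_pmull A (ltn0Sn m); lia.
Qed.

(** If F_(i+1) <= ||k|| < F_(i+2), the i-th lattice basis forces ||b k|| >= F_(n-i). The 3 comes
    from the addition formula: N = F_(i+1) F_(n-i+1) + F_i F_(n-i) <= 3 F_(i+1) F_(n-i). *)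
Lemma fib_dist_mul (n : nat) (k : int) : (0 < n)%N -> ~~ (fibn n %| k)%Z ->
  (fibn n <= 3 * (idist (fibn n) k * idist (fibn n) ((fibn n.-1)%:Z * k)))%N.
Proof.
move=> n0 hk; set N := fibn n.
have N0 : (0 < N)%N by apply: fibn_gt0.
have [x /dvdzP[q hx] xk] := idistP k N0.
have [y /dvdzP[q' hy] yk] := idistP ((fibn n.-1)%:Z * k) N0.
have x0 : (0 < `|x|)%N.
  by rewrite xk lt0n idist_eq0.
have xN : (`|x| < N)%N.
  have := idist_bound k N0; rewrite -xk; lia.
have [|i hi /andP[i1 i2]] := @fibz_bracket n `|x|; first by rewrite x0.
have := @fib_lattice_basis n i x y hi.
have -> : fibz n = fibn n.-1 by case: (n) n0.
case.
  apply/dvdzP; exists (q' - (fibn n.-1)%:Z * q).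
  rewrite [fibz _]/= -/N; move: hx hy; set B := (fibn n.-1)%:Z => hx hy.
  have -> : x = k - q * N by lia.
  have -> : y = B * k - q' * N by lia.
  ring.
move=> a [b [e he [ex ey]]].
have hF : (0 < fibz (n - i))%N.
  by have -> : (n - i = (n - i.+1).+1)%N by [lia|]; exact: fibz_gt0.
have yF : (fibz (n - i) <= `|y|)%N.
  have -> : `|y|%N = `|(a * (fibz (n - i))%:Z - b * (fibz (n - i).-1)%:Z)%R|%N.
    by rewrite ey; case: he => ->; clear; lia.
  apply: (@lattice_coords_bound _ _ _ _ (fibz i.+1) (fibz i.+2)).
    exact: fibz_gt0.
  by rewrite -ex i1 i2.
rewrite -xk -yk.
have : (N <= 3 * (fibz i.+1 * fibz (n - i)))%N.
  rewrite /N -[fibn n]/(fibz n.+1) -{1}(subnKC (ltnW hi)) fibzD.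
  have := fibz_le i; have := fibz_le (n - i).
  have -> : (n - i = (n - i.+1).+1)%N by lia.
  rewrite fibzS; have := fibz_le (n - i.+1); clear; nia.
move/leq_trans; apply; rewrite leq_mul2l /=; exact: leq_mul.
Qed.

Local Open Scope complex_scope.

(** * Trigonometric sums on Z/N *)

Section FiniteFourier.
Variables (R : rcfType) (N : nat) (w : R[i]).
Hypothesis N_gt0 : (0 < N)%N.
Hypothesis wN : w ^+ N = 1.
Hypothesis normw : `|w| = 1.
Hypothesis w_gap : forall k : int,
  ((idist N k)%:R / N%:R)%:C <= `|w ^ k - 1|.

Lemma root_neq0 : w != 0.
Proof. by rewrite -normr_gt0 normw ltr01. Qed.
Hint Resolve root_neq0 : core.

Lemma rootD (k l : int) : w ^ (k + l) = w ^ k * w ^ l.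
Proof. exact: expfzDr. Qed.

Lemma root_dvd (k : int) : (N %| k)%Z -> w ^ k = 1.
Proof. by case/dvdzP=> q ->; rewrite mulrC -exprz_exp -exprnP wN exp1rz. Qed.

Lemma root_eqmod (k l : int) : (N %| k - l)%Z -> w ^ k = w ^ l.
Proof. by move=> /root_dvd h; rewrite -(subrK l k) rootD h mul1r. Qed.

Lemma norm_root (k : int) : `|w ^ k| = 1.
Proof.
case: k => n; rewrite ?NegzE -?exprnP -?exprnN ?normfV normrX normw expr1n //.
by rewrite invr1.
Qed.

Lemma conj_root (k : int) : (w ^ k)^* = w ^ (- k).
Proof. by rewrite -invr_expz invc_norm norm_root expr1n invr1 mul1r. Qed.

Lemma root_eq1 (k : int) : (w ^ k == 1) = (N %| k)%Z.
Proof.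
apply/idP/idP => [/eqP h|/root_dvd ->] //.
have := w_gap k; rewrite h subrr normr0 -[0]/(0%:C) lecR => hk.
rewrite -idist_eq0 // -leqn0 -(@ler_nat R).
by move: hk; rewrite pmulr_lle0 // invr_gt0 ltr0n.
Qed.

Lemma sum_root (k : int) :
  \sum_(m < N) w ^ (k * m%:Z) = if (N %| k)%Z then N%:R else 0.
Proof.
have E : \sum_(m < N) w ^ (k * m%:Z) = \sum_(m < N) (w ^ k) ^+ m.
  by apply: eq_bigr => m _; rewrite -exprz_exp -exprnP.
rewrite E; case: ifPn => [/root_dvd ->|hk].
  under eq_bigr do rewrite expr1n.
  by rewrite sumr_const card_ord.
have := subrX1 (w ^ k) N.
rewrite [_ ^+ N]exprnP exprz_exp mulrC -exprz_exp -exprnP wN exp1rz subrr.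
move/esym/eqP; rewrite mulf_eq0 subr_eq0 root_eq1 (negPf hk) /= => /eqP //.
Qed.

(** Trigonometric polynomials with frequencies in [-a, a], shifted by a so as to become ordinary
    polynomials in w^m: products and powers are then those of polynomials, and [size] tracks the
    bandwidth. *)
Definition bandlimited (a : nat) (f : nat -> R[i]) :=
  exists2 P : {poly R[i]}, (size P <= (2 * a).+1)%N &
    forall m : nat, f m = w ^ (- (a%:Z * m%:Z)) * P.[w ^ m%:Z].

Lemma bandlimited_eq a f g : f =1 g -> bandlimited a f -> bandlimited a g.
Proof. by move=> fg [P sP hP]; exists P => // m; rewrite -fg. Qed.

Lemma bandlimited_root a (k : int) : (idist N k <= a)%N ->
  bandlimited a (fun m => w ^ (k * m%:Z)).
Proof.
move=> ka; have [y hy ya] := idistP k N_gt0.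
exists 'X^(`|(a%:Z + y)%R|%N).
  by rewrite size_polyXn; lia.
move=> m; rewrite hornerXn (exprnP (w ^ _)) exprz_exp -rootD.
apply: root_eqmod; case/dvdzP: hy => q hq; apply/dvdzP; exists (q * m%:Z).
have -> : (`|(a%:Z + y)%R|%N : int) = a%:Z + y by lia.
have -> : k = q * N%:Z + y by lia.
ring.
Qed.

Lemma bandlimitedD a f g : bandlimited a f -> bandlimited a g ->
  bandlimited a (fun m => f m + g m).
Proof.
move=> [P sP hP] [Q sQ hQ]; exists (P + Q).
  by rewrite (leq_trans (size_polyD _ _)) // geq_max sP.
by move=> m; rewrite hP hQ hornerD mulrDr.
Qed.

Lemma bandlimited0 a : bandlimited a (fun=> 0).
Proof. by exists 0 => [|m]; rewrite ?size_poly0 ?horner0 ?mulr0. Qed.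

Lemma bandlimitedZ a c f : bandlimited a f -> bandlimited a (fun m => c * f m).
Proof.
move=> [P sP hP]; exists (c *: P); first by rewrite (leq_trans (size_scale_leq _ _)).
by move=> m; rewrite hP hornerZ mulrCA.
Qed.

Lemma bandlimited_sum a (I : Type) (r : seq I) (P : pred I) (F : I -> nat -> R[i]) :
  (forall i, P i -> bandlimited a (F i)) ->
  bandlimited a (fun m => \sum_(i <- r | P i) F i m).
Proof.
move=> h; elim: r => [|i r IH].
  by apply: bandlimited_eq (bandlimited0 a) => m; rewrite big_nil.
case Pi : (P i).
  apply: bandlimited_eq (bandlimitedD (h _ Pi) IH) => m.
  by rewrite big_cons Pi.
by apply: bandlimited_eq IH => m; rewrite big_cons Pi.
Qed.

Lemma bandlimitedM a b f g : bandlimited a f -> bandlimited b g ->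
  bandlimited (a + b) (fun m => f m * g m).
Proof.
move=> [P sP hP] [Q sQ hQ]; exists (P * Q).
  by rewrite (leq_trans (size_polyMleq _ _)) //; lia.
move=> m; rewrite hP hQ hornerM mulrACA -rootD; congr (w ^ _ * _).
by rewrite PoszD; ring.
Qed.

Lemma bandlimitedX a f n : bandlimited a f ->
  bandlimited (n * a) (fun m => f m ^+ n).
Proof.
move=> h; elim: n => [|n IH].
  exists 1 => [|m]; first by rewrite size_poly1.
  by rewrite hornerC mulr1 mul0n mul0r oppr0.
rewrite mulSn; apply: bandlimited_eq (bandlimitedM h IH) => m.
by rewrite exprS.
Qed.

(** A frequency of f cancelling k modulo N would place k within a of a multiple of N. *)
Lemma bandlimited_orth a f (k : int) : bandlimited a f -> (a < idist N k)%N ->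
  \sum_(m < N) f m * w ^ (k * m%:Z) = 0.
Proof.
move=> [P sP hP] ak.
under eq_bigr do rewrite hP (horner_coef_wide _ sP) mulr_sumr mulr_suml.
rewrite exchange_big big1 //= => i _.
have E (m : 'I_N) : w ^ (- (a%:Z * m%:Z)) * (P`_i * (w ^ m%:Z) ^+ i) * w ^ (k * m%:Z)
    = P`_i * w ^ ((k + i%:Z - a%:Z) * m%:Z).
  rewrite (exprnP (w ^ _)) exprz_exp [w ^ _ * (_ * _)]mulrCA -!mulrA -!rootD.
  by congr (_ * w ^ _); ring.
under eq_bigr do rewrite E.
rewrite -mulr_sumr sum_root; case: ifPn => [|_]; last by rewrite mulr0.
move=> hd; suff : (idist N k <= a)%N by lia.
have -> : idist N k = idist N (a%:Z - i%:Z).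
  have h1 : (N %| k - (a%:Z - i%:Z))%Z.
    by rewrite opprB addrA.
  have := idistD (k - (a%:Z - i%:Z)) (a%:Z - i%:Z) N_gt0.
  have := idistD (- (k - (a%:Z - i%:Z))) k N_gt0.
  have e1 : - (k - (a%:Z - i%:Z)) + k = a%:Z - i%:Z by ring.
  rewrite subrK e1.
  rewrite idistN //; move: h1; rewrite -idist_eq0 // => /eqP ->; lia.
have := ltn_ord i; move=> hi.
apply: (@leq_trans `|(a%:Z - i%:Z)%R|%N); last by lia.
by apply: idist_le => //; rewrite subrr dvdz0.
Qed.

Section TrigSum.
Variables (I : finType) (S : pred I) (c : I -> R[i]) (freq : I -> int).

Definition trigsum (m : nat) : R[i] := \sum_(i | S i) c i * w ^ (freq i * m%:Z).

(** Taking the real part adds the opposite frequencies, which are at the same distance from N Z. *)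
Lemma bandlimited_Re_trigsum a : (forall i, S i -> (idist N (freq i) <= a)%N) ->
  bandlimited a (fun m => (complex.Re (trigsum m))%:C).
Proof.
move=> h.
apply: (@bandlimited_eq a (fun m => 2^-1 *
   (\sum_(i | S i) c i * w ^ (freq i * m%:Z) +
    \sum_(i | S i) (c i)^* * w ^ (- freq i * m%:Z)))).
  move=> m; rewrite ReJ_add mulrC; congr ((_ + _) * _).
  rewrite /trigsum rmorph_sum /=; apply: eq_bigr => i _.
  by rewrite rmorphM /= conj_root mulNr.
apply: bandlimitedZ; apply: bandlimitedD; apply: bandlimited_sum => i Si;
  apply: bandlimitedZ; apply: bandlimited_root; rewrite ?idistN //; exact: h.
Qed.

Lemma orth_Re_trigsum a (f : nat -> R) : bandlimited a (fun m => (f m)%:C) ->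
  (forall i, S i -> (a < idist N (freq i))%N) ->
  \sum_(m < N) f m * complex.Re (trigsum m) = 0.
Proof.
move=> hf h.
have -> : \sum_(m < N) f m * complex.Re (trigsum m) =
   complex.Re (\sum_(m < N) (f m)%:C * trigsum m).
  rewrite raddf_sum /=; apply: eq_bigr => m _.
  by case: (trigsum m) => x y /=; rewrite mul0r subr0.
rewrite [X in complex.Re X](_ : _ = 0) //.
under eq_bigr do rewrite mulr_sumr.
rewrite exchange_big big1 //= => i Si.
under eq_bigr do rewrite mulrCA.
by rewrite -mulr_sumr (bandlimited_orth hf) ?mulr0 //; exact: h.
Qed.

Lemma parseval_trigsum : {in S &, forall i j, (N %| freq i - freq j)%Z -> i = j} ->
  \sum_(m < N) `|trigsum m| ^+ 2 = N%:R * \sum_(i | S i) `|c i| ^+ 2.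
Proof.
move=> h.
under eq_bigr => m _ do rewrite sqr_normc {2}/trigsum rmorph_sum mulr_sumr /=.
rewrite exchange_big /= mulr_sumr; apply: eq_bigr => i Si.
under eq_bigr => m _ do rewrite mulr_suml.
rewrite exchange_big /= (bigD1 i) //= [X in _ + X]big1 ?addr0.
  rewrite sqr_normc; under eq_bigr => m _.
    rewrite rmorphM /= mulrACA -sqr_normc -sqr_normc norm_root expr1n mulr1.
    over.
  by rewrite sumr_const card_ord mulr_natl sqr_normc.
move=> j /andP[Sj ji].
under eq_bigr => m _.
  rewrite rmorphM /= mulrACA conj_root -rootD -mulNr -mulrDl; over.
rewrite -mulr_sumr sum_root ifN ?mulr0 //.
by apply: contra ji => /h -> //.
Qed.

(** Interpolation between the supremum bound n a and Parseval's n a^2. It gains a factor 1/n over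
    the trivial bound (n a)^(2q); the decay in the block size rests on this gain. *)
Lemma pnorm_Re_trigsum (q n : nat) (a : R) : (0 < q)%N ->
  {in S &, forall i j, (N %| freq i - freq j)%Z -> i = j} ->
  (forall i, S i -> `|c i| <= a%:C) -> 0 <= a -> (#|S| <= n)%N ->
  \sum_(m < N) complex.Re (trigsum m) ^+ (2 * q) <=
    N%:R * (n%:R ^+ (2 * q).-1 * a ^+ (2 * q)).
Proof.
move=> q0 hinj ca a0 Sn.
pose s m := complex.Re (trigsum m) ^+ 2 + complex.Im (trigsum m) ^+ 2.
have sE m : (s m)%:C = `|trigsum m| ^+ 2 by rewrite /s add_Re2_Im2.
have s0 m : 0 <= s m by rewrite addr_ge0 ?sqr_ge0.
have sn m : s m <= (n%:R * a) ^+ 2.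
  rewrite -lecR sE rmorphXn /= lerXn2r ?nnegrE ?normr_ge0 //.
    by rewrite ler0c mulr_ge0.
  rewrite (le_trans (ler_norm_sum _ _ _)) //.
  apply: (@le_trans _ _ (\sum_(i | S i) a%:C)).
    by apply: ler_sum => i Si; rewrite normrM norm_root mulr1; exact: ca.
  rewrite sumr_const -rmorphMn /= lecR -mulr_natl ler_wpM2r // ler_nat.
  exact: Sn.
have ssum : \sum_(m < N) s m <= N%:R * (n%:R * a ^+ 2).
  rewrite -lecR rmorph_sum /=; under eq_bigr do rewrite sE.
  rewrite parseval_trigsum // !rmorphM /= !rmorph_nat ler_wpM2l ?ler0n //.
  apply: (@le_trans _ _ (\sum_(i | S i) (a%:C) ^+ 2)).
    by apply: ler_sum => i Si; rewrite lerXn2r ?nnegrE ?normr_ge0 ?ler0c ?ca.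
  rewrite sumr_const -expr2 -[X in X <= _]mulr_natl ler_wpM2r ?exprn_ge0 ?ler0c //.
  by rewrite ler_nat.
case: q q0 => // q _.
apply: (@le_trans _ _ (\sum_(m < N) (n%:R * a) ^+ (2 * q) * s m)).
  apply: ler_sum => m _; rewrite mulnS addnC exprD.
  have R2 : complex.Re (trigsum m) ^+ 2 <= s m by rewrite lerDl sqr_ge0.
  rewrite !exprM; apply: ler_pM; rewrite ?sqr_ge0 //; first by rewrite exprn_ge0 ?sqr_ge0.
  rewrite lerXn2r ?nnegrE ?sqr_ge0 //; exact: le_trans (sn m).
rewrite -mulr_sumr.
apply: le_trans (_ : (n%:R * a) ^+ (2 * q) * (N%:R * (n%:R * a ^+ 2)) <= _).
  by rewrite ler_wpM2l // exprn_ge0 // mulr_ge0.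
have -> : (2 * q.+1 = (2 * q).+2)%N by lia.
by rewrite -pred_Sn exprMn le_eqVlt !exprS; apply/orP; left; apply/eqP; ring.
Qed.

End TrigSum.
End FiniteFourier.

(** * Inequalities for means of even powers *)

Section PowerInequalities.
Variable R : realFieldType.

Lemma expr_double_ge0 (x : R) q : 0 <= x ^+ (2 * q).
Proof. by rewrite exprM exprn_ge0 // sqr_ge0. Qed.

Lemma normrX_double (x : R) q : `|x| ^+ (2 * q) = x ^+ (2 * q).
Proof. by rewrite -normrX ger0_norm // expr_double_ge0. Qed.

Lemma mixed_power_le (x d : R) (q a b : nat) : (a + b = 2 * q)%N ->
  x ^+ a * d ^+ (b + 2) <= x ^+ (2 * q) * d ^+ 2 + d ^+ (2 * q.+1).
Proof.
move=> ab; apply: le_trans (ler_norm _) _.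
rewrite normrM !normrX -(normrX_double x) -(normrX_double d).
have -> : d ^+ 2 = `|d| ^+ 2 by rewrite -normrX ger0_norm // sqr_ge0.
move: `|x| `|d| (normr_ge0 x) (normr_ge0 d) => {}x {}d x0 d0.
case: (lerP x d) => xd.
  apply: le_trans (_ : d ^+ (2 * q.+1) <= _); last first.
    by rewrite lerDr mulr_ge0 ?exprn_ge0.
  have -> : (2 * q.+1 = a + (b + 2))%N by lia.
  by rewrite (exprD _ a) ler_wpM2r ?exprn_ge0 // lerXn2r.
apply: le_trans (_ : x ^+ (2 * q) * d ^+ 2 <= _); last first.
  by rewrite lerDl exprn_ge0.
rewrite -ab !exprD -!mulrA ler_wpM2l ?exprn_ge0 //.
by rewrite ler_wpM2r ?exprn_ge0 // lerXn2r ?nnegrE // ltW.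
Qed.

(** The linear term is kept exactly, as its mean will vanish by orthogonality. Each later term of
    the binomial formula is absorbed by the extreme ones, and 2^(2q+2) bounds the sum of the
    binomial coefficients. *)
Lemma even_power_taylor (x d : R) (q : nat) :
  (x + d) ^+ (2 * q.+1) <= x ^+ (2 * q.+1) + (2 * q.+1)%:R * (x ^+ (2 * q).+1 * d)
    + (2 ^ (2 * q.+1))%:R * (x ^+ (2 * q) * d ^+ 2 + d ^+ (2 * q.+1)).
Proof.
have E : (2 * q.+1 = (2 * q).+2)%N by lia.
have mix a b := @mixed_power_le x d q a b.
have : 0 <= x ^+ (2 * q) * d ^+ 2 + d ^+ (2 * q.+1).
  by rewrite addr_ge0 ?expr_double_ge0 // mulr_ge0 ?expr_double_ge0 ?sqr_ge0.
rewrite E in mix *; move: (2 * q)%N mix => n mix.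
set T := _ + d ^+ _ in mix * => T0.
rewrite exprDn 2!big_ord_recl /= addrA.
rewrite subn0 expr0 mulr1 bin0 mulr1n subn1 /= expr1 bin1 lerD //.
  by rewrite lerD2l mulr_natl.
apply: le_trans (_ : \sum_(i < n.+1) T *+ 'C(n.+2, i.+2) <= _).
  apply: ler_sum => i _; rewrite /bump /= !add1n lerMn2r; apply/orP; right.
  have := mix (n - i)%N i; rewrite addn2 subSS subSS; apply.
  by rewrite subnK // -ltnS.
rewrite sumrMnr -[leLHS]mulr_natl ler_wpM2r // ler_nat.
have := expnDn 1 1 n.+2.
rewrite (_ : (1 + 1 = 2)%N) // => ->.
rewrite 2!big_ord_recl addnA.
apply: leq_trans (leq_addl _ _).
by apply: leq_sum => i _; rewrite !exp1n !muln1.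
Qed.

(** In terms of squared norms, a term orthogonal to X^(2q+1) adds only a multiple of b^2, while A
    keeps the coefficient 1: such a bound survives an induction of any length. *)
Lemma mean_power_step (M q : nat) (X d : nat -> R) (A b : R) :
  0 < A -> 0 < b ->
  \sum_(m < M) X m ^+ (2 * q.+1) <= M%:R * A ^+ q.+1 ->
  \sum_(m < M) d m ^+ (2 * q.+1) <= M%:R * b ^+ (2 * q.+1) ->
  \sum_(m < M) X m ^+ (2 * q).+1 * d m = 0 ->
  \sum_(m < M) (X m + d m) ^+ (2 * q.+1) <=
    M%:R * (A + 3 * (2 ^ (2 * q.+1))%:R * b ^+ 2) ^+ q.+1.
Proof.
move=> A0 b0 hX hd ho; set K : R := (2 ^ (2 * q.+1))%:R.
have K1 : 1 <= K by rewrite ler1n expn_gt0.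
(* A substitute for Hölder's inequality: normalised by A and b^2, it reduces to u^q v <= u^(q+1) +
   v^(q+1), which costs the factor 2. *)
have mix : \sum_(m < M) X m ^+ (2 * q) * d m ^+ 2 <= M%:R * (2 * A ^+ q * b ^+ 2).
  have pt x y : x ^+ (2 * q) * y ^+ 2 <= A ^+ q * b ^+ 2 *
      (x ^+ (2 * q.+1) / A ^+ q.+1 + y ^+ (2 * q.+1) / b ^+ (2 * q.+1)).
    rewrite [x ^+ _]exprM [x ^+ (2 * _)]exprM [y ^+ (2 * _)]exprM [b ^+ (2 * _)]exprM.
    rewrite -(expr_div_n (x ^+ 2)) -(expr_div_n (y ^+ 2)).
    have -> : (x ^+ 2) ^+ q * y ^+ 2 =
       A ^+ q * b ^+ 2 * ((x ^+ 2 / A) ^+ q * (y ^+ 2 / b ^+ 2)).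
      rewrite expr_div_n; field.
      by rewrite !gt_eqF ?exprn_gt0.
    rewrite ler_wpM2l ?mulr_ge0 ?exprn_ge0 ?(ltW A0) ?(ltW b0) //.
    have : 0 <= x ^+ 2 / A by rewrite divr_ge0 ?sqr_ge0 // ltW.
    have : 0 <= y ^+ 2 / b ^+ 2 by rewrite divr_ge0 ?sqr_ge0.
    move: (_ / A) (_ / (b ^+ 2)) => v u u0 v0.
    case: (lerP v u) => vu; rewrite !exprSr.
      rewrite -[leLHS]add0r lerD ?mulr_ge0 ?exprn_ge0 //.
      by rewrite ler_wpM2r // lerXn2r.
    rewrite -[leLHS]addr0 lerD ?mulr_ge0 ?exprn_ge0 //.
    by rewrite ler_wpM2l ?exprn_ge0 // ltW.
  apply: le_trans; first by apply: ler_sum => m _; exact: pt.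
  rewrite -mulr_sumr big_split /= -!mulr_suml.
  have -> : M%:R * (2 * A ^+ q * b ^+ 2) = A ^+ q * b ^+ 2 * (M%:R + M%:R) by ring.
  rewrite ler_wpM2l ?mulr_ge0 ?exprn_ge0 ?(ltW A0) ?(ltW b0) //.
  by rewrite lerD // ler_pdivrMr ?exprn_gt0.
apply: le_trans; first by apply: ler_sum => m _; exact: even_power_taylor.
rewrite !big_split /= -!mulr_sumr ho mulr0 addr0 big_split /=.
have {}hX := lerD hX (ler_wpM2l (le_trans ler01 K1) (lerD mix hd)).
apply: le_trans hX _.
have -> : M%:R * A ^+ q.+1 + K * (M%:R * (2 * A ^+ q * b ^+ 2) + M%:R * b ^+ (2 * q.+1))
   = M%:R * (A ^+ q.+1 + 2 / 3 * (A ^+ q * (3 * K * b ^+ 2)) + K * (b ^+ 2) ^+ q.+1).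
  by rewrite -exprM; field.
rewrite ler_wpM2l //; set y := 3 * K * b ^+ 2.
have y0 : 0 < y by rewrite !mulr_gt0 ?exprn_gt0 //; lra.
(* The factor 3 in y leaves room for both error terms: the conclusion is 2/3 of [h1] plus 1/3 of
   [h2], with [h3] for the pure power of b. *)
have h1 : A ^+ q.+1 + A ^+ q * y <= (A + y) ^+ q.+1.
  rewrite (exprSr A) (exprSr (A + y)) -mulrDr ler_wpM2r ?lerXn2r ?nnegrE //; lra.
have h2 : A ^+ q.+1 + y ^+ q.+1 <= (A + y) ^+ q.+1.
  rewrite (exprSr A) (exprSr y) (exprSr (A + y)) mulrDr lerD // ler_wpM2r ?lerXn2r ?nnegrE //; lra.
have h3 : K * (b ^+ 2) ^+ q.+1 <= 1 / 3 * y ^+ q.+1.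
  have -> : y ^+ q.+1 = (3 * K) ^+ q.+1 * (b ^+ 2) ^+ q.+1 by exact: exprMn.
  rewrite mulrA ler_wpM2r ?(exprn_ge0 _ (sqr_ge0 b)) //.
  have h4 : 1 <= (3 * K) ^+ q by rewrite exprn_ege1 //; lra.
  have -> : 1 / 3 * (3 * K) ^+ q.+1 = (3 * K) ^+ q * K by rewrite exprSr; field.
  rewrite -[leLHS]mul1r.
  by rewrite ler_wpM2r //; lra.
lra.
Qed.

(** Convexity in the form of a tangent at m, to be averaged as in Jensen's inequality. *)
Lemma power_tangent (t m : R) p : 0 <= t -> 0 <= m ->
  m ^+ p.+1 + p.+1%:R * (m ^+ p * (t - m)) <= t ^+ p.+1.
Proof.
move=> t0 m0; elim: p => [|p IH]; first by rewrite !expr1 expr0; lra.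
have := ler_wpM2l t0 IH; rewrite -exprS; apply: le_trans.
rewrite -subr_ge0.
have -> : t * (m ^+ p.+1 + p.+1%:R * (m ^+ p * (t - m))) -
    (m ^+ p.+2 + p.+2%:R * (m ^+ p.+1 * (t - m))) = p.+1%:R * (m ^+ p * (t - m) ^+ 2).
  by rewrite !exprS -[p.+2]addn1 natrD; ring.
apply: mulr_ge0; [exact: ler0n | apply: mulr_ge0; [exact: exprn_ge0 | exact: sqr_ge0]].
Qed.

(* Minkowski's inequality, for functions of prescribed norms. *)
Lemma mean_power_sum (I : Type) (r : seq I) (M p : nat) (f : I -> nat -> R)
    (c : I -> R) (B : R) : 0 < B -> (forall i, 0 < c i) ->
  (forall i, \sum_(m < M) `|f i m| ^+ p.+1 <= M%:R * (c i * B) ^+ p.+1) ->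
  \sum_(m < M) `|\sum_(i <- r) f i m| ^+ p.+1 <=
    M%:R * ((\sum_(i <- r) c i) * B) ^+ p.+1.
Proof.
move=> B0 c0 hf; case: r => [|i0 r].
  rewrite big_nil mul0r expr0n /= mulr0 big1 // => m _.
  by rewrite big_nil normr0 expr0n.
set r' := i0 :: r; set s := \sum_(i <- r') c i.
have s0 : 0 < s.
  by rewrite /s big_cons ltr_pwDl // sumr_ge0 // => i _; exact: ltW.
have pt m : `|\sum_(i <- r') f i m| ^+ p.+1 <=
    \sum_(i <- r') s ^+ p.+1 * (c i / s * (`|f i m| / c i) ^+ p.+1).
  apply: le_trans (_ : (\sum_(i <- r') `|f i m|) ^+ p.+1 <= _).
    by rewrite lerXn2r ?nnegrE ?sumr_ge0 // ler_norm_sum.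
  set z := \sum_(i <- r') `|f i m|.
  rewrite -mulr_sumr -ler_pdivrMl ?exprn_gt0 // mulrC -expr_div_n.
  have z0 : 0 <= z / s.
    by rewrite divr_ge0 ?(ltW s0) //; apply: sumr_ge0 => i _; exact: normr_ge0.
  (* The weights c i / s sum to 1 and the weighted mean of the |f i m| / c i is z / s, so the linear
     terms cancel after summation. *)
  have tg i : c i / s * ((z / s) ^+ p.+1 +
       p.+1%:R * ((z / s) ^+ p * (`|f i m| / c i - z / s)))
     <= c i / s * (`|f i m| / c i) ^+ p.+1.
    rewrite ler_wpM2l ?divr_ge0 ?(ltW (c0 i)) ?(ltW s0) // power_tangent //.
    by rewrite divr_ge0 ?(ltW (c0 i)).
  apply: le_trans; last by apply: ler_sum => i _; exact: tg.
  have E i : c i / s * ((z / s) ^+ p.+1 +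
       p.+1%:R * ((z / s) ^+ p * (`|f i m| / c i - z / s))) =
     c i * ((z / s) ^+ p.+1 / s - p.+1%:R * (z / s) ^+ p * (z / s) / s) +
     `|f i m| * (p.+1%:R * (z / s) ^+ p / s).
    by field; rewrite !gt_eqF.
  under eq_bigr do rewrite E.
  rewrite big_split /= -!mulr_suml -/s -/z le_eqVlt; apply/orP; left; apply/eqP.
  by field; rewrite gt_eqF.
apply: le_trans; first by apply: ler_sum => m _; exact: pt.
rewrite exchange_big /=.
have E : M%:R * (s * B) ^+ p.+1 = \sum_(i <- r') s ^+ p.+1 * (c i / s) * (M%:R * B ^+ p.+1).
  rewrite -mulr_suml -mulr_sumr -mulr_suml -/s divff ?gt_eqF // exprMn; ring.
rewrite E; apply: ler_sum => i _.
under eq_bigr do rewrite mulrA.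
rewrite -mulr_sumr ler_wpM2l //.
  by rewrite mulr_ge0 ?divr_ge0 ?exprn_ge0 ?(ltW s0) ?(ltW (c0 i)).
under eq_bigr do rewrite expr_div_n.
rewrite -mulr_suml ler_pdivrMr ?exprn_gt0 // -mulrA -exprMn mulrC [B * _]mulrC.
by rewrite mulrC hf.
Qed.

End PowerInequalities.

(* A Littlewood-Paley type inequality: X^(2q+1) has too low frequencies to
   correlate with the next block, so the blocks behave like martingale
   differences. *)
Lemma lacunary_sum (R : rcfType) (N : nat) (w : R[i]) (q : nat)
    (d : nat -> nat -> R) (h : nat -> nat) (b : nat -> R) (eta : R) :
  (0 < N)%N -> w ^+ N = 1 -> `|w| = 1 -> 0 < eta -> (forall i, 0 < b i) ->
  (forall i j, (j < i)%N -> bandlimited w (h i) (fun m => (d j m)%:C)) ->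
  (forall i f, bandlimited w ((2 * q).+1 * h i) (fun m => (f m)%:C) ->
     \sum_(m < N) f m * d i m = 0) ->
  (forall i, \sum_(m < N) d i m ^+ (2 * q.+1) <= N%:R * b i ^+ (2 * q.+1)) ->
  forall n, \sum_(m < N) (\sum_(i < n) d i m) ^+ (2 * q.+1) <=
    N%:R * (eta + 3 * (2 ^ (2 * q.+1))%:R * \sum_(i < n) b i ^+ 2) ^+ q.+1.
Proof.
move=> N0 wN nw eta0 b0 hband horth hd; elim=> [|n IH].
  rewrite big1 => [|m _]; last by rewrite big_ord0 expr0n.
  by rewrite big_ord0 mulr0 addr0 mulr_ge0 // exprn_ge0 // ltW.
under eq_bigr do rewrite big_ord_recr /=.
rewrite big_ord_recr /= mulrDr addrA.
apply: (mean_power_step (X := fun m => \sum_(i < n) d i m)) => //.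
  rewrite ltr_wpDr // !mulr_ge0 // sumr_ge0 // => i _; exact: sqr_ge0.
apply: (horth n (fun m => (\sum_(i < n) d i m) ^+ (2 * q).+1)).
apply: (bandlimited_eq (f := fun m => (\sum_(i < n) (d i m)%:C) ^+ (2 * q).+1)).
  by move=> m; rewrite rmorphXn /= rmorph_sum.
apply: (bandlimitedX N0 nw (f := fun m => \sum_(i < n) (d i m)%:C)).
apply: bandlimited_sum => i _; exact: hband.
Qed.

(** * Geometric sums: the origin of the logarithm *)

Section GeometricSums.
Variables (R : realType) (D : nat).
Hypothesis D4 : (4 <= D)%N.

Let D4R : 4 <= D%:R :> R. Proof. by rewrite ler_nat. Qed.
Let D0R : 0 < D%:R :> R. Proof. by rewrite ltr0n; case: D D4. Qed.

Lemma sum_geometric_below1 (x : R) T : 0 < x ->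
  \sum_(j < T) (if x * D%:R ^+ j < 1 then x * D%:R ^+ j else 0) <= 2.
Proof.
move=> x0.
(* The second bound carries the induction: the sum so far is at most the next candidate term, hence
   at most doubled by adding it, and it is added only if below 1. *)
suff [] : \sum_(j < T) (if x * D%:R ^+ j < 1 then x * D%:R ^+ j else 0) <= 2 /\
  \sum_(j < T) (if x * D%:R ^+ j < 1 then x * D%:R ^+ j else 0) <= x * D%:R ^+ T by [].
elim: T => [|T [IH1 IH2]].
  by rewrite big_ord0 expr0; split; lra.
rewrite big_ord_recr /= exprSr.
have xT : 0 < x * D%:R ^+ T by rewrite mulr_gt0 // exprn_gt0.
rewrite mulrA; move: (\sum_(i < T) _) (x * D%:R ^+ T) xT IH1 IH2 => S y y0 IH1 IH2.
have hy : 4 * y <= y * D%:R by rewrite mulrC ler_wpM2l // ltW.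
case: ifPn => h; rewrite -?leNgt in h; split; lra.
Qed.

Lemma sum_geometric_above (z : R) T : 0 < z ->
  \sum_(j < T) (if z / D%:R ^+ j < 1 then z / D%:R ^+ j else 0) <= 2.
Proof.
move=> z0; case: T => [|T]; first by rewrite big_ord0.
have D0 : 0 < D%:R ^+ T :> R by rewrite exprn_gt0.
have zT : 0 < z / D%:R ^+ T by rewrite divr_gt0.
have := sum_geometric_below1 T.+1 zT.
rewrite (reindex_inj rev_ord_inj) /=.
have E (j : 'I_T.+1) : z / D%:R ^+ T * D%:R ^+ (T.+1 - j.+1) = z / D%:R ^+ j.
  rewrite subSS -mulrA; congr (_ * _).
  have -> : D%:R ^+ T = D%:R ^+ (T - j) * D%:R ^+ j :> R.
    by rewrite -exprD subnK // -ltnS.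
  have h k : D%:R ^+ k != 0 :> R by rewrite gt_eqF // exprn_gt0 //; lra.
  by field; rewrite !h.
by under eq_bigr do rewrite E.
Qed.

Lemma count_geometric (x z : R) T : 0 < x -> 0 < z -> 1 <= x * z ->
  \sum_(j < T) (if (1 <= x * D%:R ^+ j) && (1 <= z / D%:R ^+ j) then 1 else 0)
   <= 1 + 2 * ln (x * z).
Proof.
move=> x0 z0 xz.
have Dk k : 0 < D%:R ^+ k :> R by rewrite exprn_gt0.
pose P j := (1 <= x * D%:R ^+ j) && (1 <= z / D%:R ^+ j).
(* With j0 the last index counted, D^(n-1) <= x D^j0 <= x z. Taking logarithms, ln D >= 1 - 1/D >=
   3/4 gives the factor 2. *)
suff H : exists n : nat, \sum_(j < T) (if P j then 1 else 0) = n%:R :> R /\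
   (n = 0%N \/ exists2 j0, (j0 < T)%N & P j0 /\ D%:R ^+ n <= x * D%:R ^+ j0 * D%:R).
  have [n [-> [->|[j0 _ [/andP[_ p2] hn]]]]] := H.
    have := ln_ge0 xz; lra.
  have lnD : 3 / 4 <= ln (D%:R : R).
    have := @le_ln1Dx R (D%:R^-1 - 1); rewrite addrCA subrr addr0.
    have Di : 0 < D%:R^-1 :> R by rewrite invr_gt0.
    rewrite lnV ?posrE //.
    have : D%:R^-1 <= 4^-1 :> R by rewrite lef_pV2 ?posrE.
    move=> h1 h2; have : -1 < D%:R^-1 - 1 :> R by lra.
    by move/h2; lra.
  have hz : D%:R ^+ j0 <= z by move: p2; rewrite ler_pdivlMr // mul1r.
  have hn' : D%:R ^+ n <= x * z * D%:R.
    by apply: le_trans hn _; rewrite ler_wpM2r ?ler_wpM2l // ltW.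
  have := hn'; rewrite -ler_ln ?posrE ?mulr_gt0 //.
  rewrite lnXn //.
  rewrite (lnM (x := x * z)) ?posrE ?mulr_gt0 //.
  rewrite -[ln _ *+ n]mulr_natl; have := ln_ge0 xz; move: (ln _) (ln _) lnD => L l hl L0.
  case: n {hn hn'} => [|n] h3; first by lra.
  rewrite -addn1 natrD in h3 *.
  have : 0 <= n%:R * (l - 3 / 4) by rewrite mulr_ge0 //; lra.
  lra.
elim: T => [|T [n [IH IH']]]; first by exists 0%N; rewrite big_ord0; split=> //; left.
rewrite big_ord_recr /= IH; case: ifPn => [hT|_]; last first.
  exists n; rewrite addr0; split=> //; case: IH' => [|[j0 h1 h2]]; first by left.
  by right; exists j0 => //; exact: ltnW.
exists n.+1; rewrite -[n.+1]addn1 natrD; split=> //; right; exists T => //; split=> //.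
rewrite addn1 exprSr ler_wpM2r //.
case: IH' => [->|[j0 h1 [_ h2]]].
  by rewrite expr0; case/andP: hT.
apply: le_trans h2 _; rewrite -mulrA ler_wpM2l ?(ltW x0) // -exprSr.
by rewrite ler_weXn2l //; apply: le_trans D4R; lra.
Qed.

(** Where one of the minima is below 1 the terms are dominated by a geometric progression; where
    both are 1, which happens O(1 + ln (x z)) times, the indices are counted. *)
Lemma sum_min_min (x z : R) T : 0 < x -> 0 < z -> 1 <= x * z ->
  \sum_(j < T) Num.min 1 (x * D%:R ^+ j) * Num.min 1 (z / D%:R ^+ j)
   <= 5 + 2 * ln (x * z).
Proof.
move=> x0 z0 xz.
have Dk k : 0 < D%:R ^+ k :> R by rewrite exprn_gt0.
have h1 := sum_geometric_below1 T x0.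
have h2 := sum_geometric_above T z0.
have h3 := count_geometric T x0 z0 xz.
apply: le_trans (_ : 2 + 2 + (1 + 2 * ln (x * z)) <= _); last lra.
apply: le_trans (lerD (lerD h1 h2) h3).
rewrite -!big_split /=; apply: ler_sum => j _.
have a0 : 0 < x * D%:R ^+ j by rewrite mulr_gt0.
have b0 : 0 < z / D%:R ^+ j by rewrite divr_gt0.
move: (x * _) (z / _) a0 b0 => a b a0 b0.
by case: (ltP a 1) => ha; case: (ltP b 1) => hb /=;
  rewrite ?(min_l ha) ?(min_l hb) ?(min_r (ltW ha)) ?(min_r (ltW hb)); nra.
Qed.

End GeometricSums.

(* Pigeonhole: the k's with ||b k|| < P have pairwise distances at least
   N / (6 P). *)
Lemma count_frequencies (N : nat) (b : int) (S : pred 'I_N) (P Q M : nat) :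
  (0 < N)%N ->
  (forall k : int, ~~ (N %| k)%Z -> (N <= 3 * (idist N k * idist N (b * k)))%N) ->
  (forall k : 'I_N, S k -> (idist N (b * k%:Z) < P)%N /\ (idist N k < Q)%N) ->
  (12 * (P * Q) <= M * N)%N -> (#|S| <= M.+1)%N.
Proof.
move=> N0 hN hS hM.
have hrep (k : 'I_N) : {z : int | (N %| k%:Z - z)%Z && (`|z|%N == idist N k)}.
  by apply: sigW; have [y h1 h2] := idistP k N0; exists y; rewrite h1 h2 eqxx.
pose z k := sval (hrep k).
have zP (k : 'I_N) : (N %| k%:Z - z k)%Z by rewrite /z; case: (hrep k) => /= ? /andP[].
have zE (k : 'I_N) : `|z k|%N = idist N k.
  by rewrite /z; case: (hrep k) => /= ? /andP[_ /eqP].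
(* Adding Q makes the representatives nonnegative and less than 2 Q. Buckets of length N / (6 P)
   then number at most M + 1, by 12 P Q <= M N. *)
pose bucket (k : 'I_N) : nat := ((`|(z k + Q%:Z)%R| * (6 * P)) %/ N)%N.
have inj : {in S &, injective (fun k : 'I_N => inord (bucket k) : 'I_M.+1)}.
  have bnd k : S k -> (bucket k < M.+1)%N.
    move=> /hS[h1 h2]; have hz := zE k.
    rewrite /bucket ltnS -[X in (_ <= X)%N](mulnK M N0) leq_div2r //.
    apply: leq_trans hM; have : (`|(z k + Q%:Z)%R| <= 2 * Q)%N by lia.
    move: (`|_|%N) => u; nia.
  move=> k k' Sk Sk' /(congr1 val) /=; rewrite !inordK ?bnd // => hb.
  apply: contraTeq isT => kk'.
  have dk : ~~ (N %| k%:Z - k'%:Z)%Z.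
    apply: contra kk'; rewrite -eqz_mod_dvd !modz_nat eqz_nat !modn_small //.
  have := hN _ dk.
  have [p1 q1] := hS _ Sk; have [p2 q2] := hS _ Sk'.
  have : (idist N (b * (k%:Z - k'%:Z)) < 2 * P)%N.
    have := idistD (b * k%:Z) (- (b * k'%:Z)) N0.
    rewrite idistN // mulrBr; move: p1 p2.
    move: (idist N (b * k)) (idist N (b * k')) (idist N (_ - _)).
    by clear; lia.
  have : (idist N (k%:Z - k'%:Z) <= `|(z k - z k')%R|)%N.
    apply: idist_le => //.
    have /dvdzP[c1 e1] := zP k; have /dvdzP[c2 e2] := zP k'.
    apply/dvdzP; exists (c1 - c2); rewrite mulrBl -e1 -e2; ring.
  have e : `|(z k - z k')%R|%N = `|(`|(z k + Q%:Z)%R|%:Z - `|(z k' + Q%:Z)%R|%:Z)%R|%N.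
    have := zE k; have := zE k'; lia.
  rewrite e; move: hb; rewrite /bucket.
  move: (`|(z k + _)%R|%N) (`|(z k' + _)%R|%N) => u u' hb.
  have := divn_eq (u * (6 * P)) N; have := divn_eq (u' * (6 * P)) N.
  have := ltn_pmod (u * (6 * P)) N0; have := ltn_pmod (u' * (6 * P)) N0.
  rewrite hb; move: (_ %/ _)%N => c.
  move: ((u * _) %% _)%N ((u' * _) %% _)%N => r r' r1 r2 e1 e2 h1 h2 h3.
  have h4 : (`|(u%:Z - u'%:Z)%R| * (6 * P) < N)%N.
    have -> : (6 * P = `|(6 * P)%N%:Z|)%N by [].
    rewrite -abszM.
    have -> : (u%:Z - u'%:Z) * (6 * P)%N%:Z = r%:Z - r'%:Z.
      by rewrite mulrBl -!PoszM; move: e1 e2; clear; lia.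
    by move: r1 r2; clear; lia.
  move: h1 h2 h3 h4; move: (idist N _) (idist N _) (`|_|%N); clear -N0; nia.
rewrite -(card_in_imset inj) (leq_trans (max_card _)) ?card_ord //.
Qed.

(** * Dyadic blocks of frequencies *)

Lemma min_le_inv_mul (R : realFieldType) (u x t : R) : 0 < t -> x <= t^-1 ->
  Num.min u x <= t^-1 * Num.min 1 (u * t).
Proof.
move=> t0 xt; rewrite minr_pMr ?invr_ge0 ?(ltW t0) // mulr1.
have -> : t^-1 * (u * t) = u by field; rewrite gt_eqF.
by rewrite le_min !ge_min xt lexx orbT.
Qed.

Lemma exprM_div (F : fieldType) (x y : F) k : x != 0 ->
  x ^+ k.+1 * y ^+ k.+2 = (x * y) ^+ k.+2 / x.
Proof. by move=> x0; rewrite exprMn (exprS x k.+1) [RHS]mulrC -[x * _ * _]mulrA mulKf. Qed.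

Lemma le_min1 (R : realFieldType) (x y : R) : x <= y -> Num.min 1 x <= Num.min 1 y.
Proof. by move=> xy; rewrite le_min !ge_min lexx xy orbT. Qed.

(** The 4 is the sum of 2^-s over all s and both parities; the square root comes from
    [lacunary_sum], and 13 D^3 from the cardinality and the coefficients of a block. *)
Definition square_function_const (R : realType) (q : nat) : R :=
  let D : R := (4 ^ (2 * q.+1))%:R in
  4 * (Num.sqrt (1 + 3 * (2 ^ (2 * q.+1))%:R * (7 + 2 * ln D)) * (13 * D ^+ 3)).

Section DyadicBlocks.
Variables (R : realType) (N q : nat) (w : R[i]) (b : int).
Variables (c : 'I_N -> R[i]) (A u v : R).
Hypothesis N_gt0 : (0 < N)%N.
Hypothesis wN : w ^+ N = 1.
Hypothesis normw : `|w| = 1.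
Hypothesis w_gap : forall k : int,
  ((idist N k)%:R / N%:R)%:C <= `|w ^ k - 1|.
Hypothesis hN : forall k : int, ~~ (N %| k)%Z ->
  (N <= 3 * (idist N k * idist N (b * k)))%N.
Hypothesis A_gt0 : 0 < A.
Hypothesis u_gt0 : 0 < u.
Hypothesis v_gt0 : 0 < v.
Hypothesis cA : forall k : 'I_N, (0 < k)%N ->
  `|c k| <= (A * (Num.min u (idist N (b * k%:Z))%:R^-1 *
                  Num.min v (idist N k%:Z)%:R^-1))%:C.

(* The base is such that D^-1 = 4^-(2q+2): this turns the factor (#block)^-1 of
   the L^p estimate, p = 2q+2, into geometric decay of the norm. *)
Variable D : nat.
Hypothesis DE : D = (4 ^ (2 * q.+1))%N.
Let jj (k : int) := trunc_log D (idist N (b * k)).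
Let ll (k : int) := trunc_log D (idist N k).
Let t0 := trunc_log D N.
Let ss (k : int) := (jj k + ll k + 2 - t0)%N.
(* For fixed s, ||k|| ||b k|| is of order D^s N on the block; the parity of j
   separates the frequencies b k of distinct blocks by a factor D. *)
Let S (s : nat) (par : bool) (j : nat) : pred 'I_N := fun k =>
  [&& (0 < k)%N, jj k%:Z == j, ss k%:Z == s & odd j == par].
Let freq (k : 'I_N) : int := b * k%:Z.
Let d s par j (m : nat) : R := complex.Re (trigsum w (S s par j) c freq m).
(** The cutoffs min(1, u ||b k||) and min(1, v ||k||) on a block, up to constants: there ||k|| is of
    order N D^s / D^j. *)
Let m2 s j : R := Num.min 1 (u * D%:R ^+ j) * Num.min 1 (v * N%:R * D%:R ^+ s / D%:R ^+ j).
Let B0 : R := 13 * D%:R ^+ 3 * A / N%:R.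

Let D_ge4 : (4 <= D)%N.
Proof. by rewrite DE -{1}(expn1 4) leq_exp2l. Qed.

Let D_gt1 : (1 < D)%N. Proof. by apply: leq_trans D_ge4. Qed.

Let D_gtq : ((2 * q).+1 < D)%N.
Proof.
rewrite DE; apply: (@leq_trans (2 ^ (2 * q.+1))%N).
  by have -> : (2 * q.+1 = (2 * q).+2)%N by [lia|]; exact: ltnW (ltn_expl _ _).
by rewrite leq_exp2r.
Qed.

Let not_dvd (k : 'I_N) : (0 < k)%N -> ~~ (N %| k%:Z)%Z.
Proof.
move=> k0; rewrite -[(_ \in _)]/((N %| k)%N); apply/negP => /dvdn_leq -/(_ k0).
by rewrite leqNgt ltn_ord.
Qed.

Let freq_inj : {in [pred k : 'I_N | (0 < k)%N] &,
  forall k l, (N %| freq k - freq l)%Z -> k = l}.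
Proof.
move=> k l; rewrite !inE => k0 l0 h; apply/eqP/negPn/negP => kl.
have dk : ~~ (N %| k%:Z - l%:Z)%Z.
  by apply: contra kl; rewrite -eqz_mod_dvd !modz_nat eqz_nat !modn_small.
have := hN dk; rewrite mulrBr; move: h; rewrite -idist_eq0 // => /eqP ->.
by rewrite !muln0 leqn0; case: (N) N_gt0.
Qed.

Let block_bounds s par j (k : 'I_N) : S s par j k ->
  [/\ (D ^ j <= idist N (freq k) < D ^ j.+1)%N,
      exists2 l, (j + l + 2 = s + t0)%N & (D ^ l <= idist N k%:Z < D ^ l.+1)%N
    & odd j = par].
Proof.
move=> /and4P[k0 /eqP hj /eqP hs /eqP hp].
have := hN (not_dvd k0) => h.
have x0 : (0 < idist N (b * k%:Z))%N.
  by rewrite lt0n; apply/negP => /eqP e; move: h; rewrite e !muln0; lia.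
have y0 : (0 < idist N k%:Z)%N.
  by rewrite lt0n; apply/negP => /eqP e; move: h; rewrite e !muln0; lia.
have hx := trunc_log_bounds D_gt1 x0; have hy := trunc_log_bounds D_gt1 y0.
rewrite -/(jj k) hj in hx; rewrite -/(ll k) in hy.
split => //; exists (ll k) => //.
(* So the subtraction in [ss] is never truncated: its 2 compensates for the factor 3 in [hN] and for
   the rounding of the two logarithms. *)
suff : (t0 <= j + ll k + 2)%N by rewrite -hs /ss hj; lia.
have /andP[hn _] := trunc_log_bounds D_gt1 N_gt0.
have hD3 : (3 < D)%N by [].
have : (D ^ t0 < D ^ (j + ll k + 3))%N.
  apply: leq_ltn_trans hn _; apply: leq_ltn_trans h _.
  have -> : (j + ll k + 3 = 1 + (j.+1 + (ll k).+1))%N by lia.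
  rewrite !(expnD D) expn1; case/andP: hx => _ hx; case/andP: hy => _ hy.
  rewrite [(idist _ _ * _)%N]mulnC; apply: ltn_mul => //; exact: ltn_mul.
by rewrite ltn_exp2l //; lia.
Qed.

(** As j and s determine l, a single pair P = D^(j+1), Q = D^(l+1) serves the whole block, and P Q =
    D^(s+t0) <= D^s N. *)
Let block_card s par j : (#|S s par j| <= 13 * D ^ s)%N.
Proof.
have [k0 hk0|] := pickP (S s par j); last first.
  by move=> /eq_card0 ->.
have [_ [l hl _] _] := block_bounds hk0.
have Ds : (0 < D ^ s)%N by rewrite expn_gt0 (ltnW D_gt1).
apply: (@leq_trans (12 * D ^ s).+1); last by lia.
apply: (@count_frequencies N b _ (D ^ j.+1) (D ^ l.+1)) => //.
  move=> k /block_bounds[/andP[_ h1] [l' hl' /andP[_ h2]] _]; split => //.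
  by have -> : l = l' by lia.
rewrite -mulnA leq_mul2l /= -expnD.
have -> : (j.+1 + l.+1 = s + t0)%N by lia.
rewrite expnD leq_mul2l; apply/orP; right.
by case/andP: (trunc_log_bounds D_gt1 N_gt0).
Qed.

Let DR_gt0 k : 0 < D%:R ^+ k :> R.
Proof. by rewrite exprn_gt0 // ltr0n ltnW. Qed.

Let NR_gt0 : 0 < N%:R :> R. Proof. by rewrite ltr0n. Qed.

Let m2_gt0 s j : 0 < m2 s j.
Proof. by rewrite /m2 mulr_gt0 // lt_min ltr01 /= ?divr_gt0 ?mulr_gt0. Qed.

Let block_coef s par j (k : 'I_N) : S s par j k ->
  `|c k| <= (A * D%:R ^+ 3 / (N%:R * D%:R ^+ s) * m2 s j)%:C.
Proof.
move=> hk; have /and4P[k0 _ _ _] := hk.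
have [/andP[h1 _] [l hl /andP[h2 _]] _] := block_bounds hk.
apply: le_trans (cA k0) _; rewrite lecR.
have -> : A * D%:R ^+ 3 / (N%:R * D%:R ^+ s) * m2 s j =
    A * (D%:R ^+ 3 / (N%:R * D%:R ^+ s) * m2 s j) by rewrite !mulrA.
rewrite ler_wpM2l //; first exact: ltW.
have i1 : (idist N (b * k%:Z))%:R^-1 <= (D%:R ^+ j)^-1 :> R.
  rewrite lef_pV2 ?posrE // -?natrX ?ler_nat // ltr0n.
  by apply: leq_trans h1; rewrite expn_gt0 (ltnW D_gt1).
have i2 : (idist N k%:Z)%:R^-1 <= (D%:R ^+ l)^-1 :> R.
  rewrite lef_pV2 ?posrE // -?natrX ?ler_nat // ltr0n.
  by apply: leq_trans h2; rewrite expn_gt0 (ltnW D_gt1).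
have /andP[n1 n2] := trunc_log_bounds D_gt1 N_gt0.
have nR1 : D%:R ^+ t0 <= N%:R :> R by rewrite -natrX ler_nat.
have nR2 : N%:R <= D%:R ^+ t0 * D%:R :> R by rewrite -exprSr -natrX ler_nat ltnW.
have D2 : 1 <= D%:R ^+ 2 :> R by rewrite exprn_ege1 // ler1n ltnW.
have e : D%:R ^+ l = D%:R ^+ s * D%:R ^+ t0 / (D%:R ^+ j * D%:R ^+ 2) :> R.
  rewrite -!exprD -hl; rewrite (addnC j l) -addnA.
  by rewrite (exprD _ l) mulfK // gt_eqF.
have e1 := min_le_inv_mul u (DR_gt0 j) i1.
have e2 : Num.min v (idist N k%:Z)%:R^-1 <=
    (D%:R ^+ l)^-1 * Num.min 1 (v * N%:R * D%:R ^+ s / D%:R ^+ j).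
  apply: le_trans (min_le_inv_mul v (DR_gt0 l) i2) _.
  rewrite ler_wpM2l ?invr_ge0 ?(ltW (DR_gt0 l)) // le_min1 // -!mulrA ler_wpM2l ?(ltW v_gt0) //.
  rewrite e [N%:R * _]mulrCA -mulrA ler_wpM2l ?(ltW (DR_gt0 s)) //.
  apply: ler_pM; rewrite ?invr_ge0 ?mulr_ge0 ?(ltW (DR_gt0 _)) //.
  rewrite lef_pV2 ?posrE ?(mulr_gt0 (DR_gt0 _) (DR_gt0 _)) //.
  by rewrite ler_peMr ?(ltW (DR_gt0 _)).
have inv_ge0 i : 0 <= (D%:R ^+ i)^-1 :> R by rewrite invr_ge0 ltW.
have m0 t : 0 < t -> 0 <= Num.min 1 t :> R by move=> t1; rewrite le_min ler01 ltW.
have E1 : 0 <= Num.min u (idist N (b * k%:Z))%:R^-1 by rewrite le_min (ltW u_gt0) invr_ge0 ler0n.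
have E2 : 0 <= Num.min v (idist N k%:Z)%:R^-1 by rewrite le_min (ltW v_gt0) invr_ge0 ler0n.
apply: le_trans (ler_pM E1 E2 e1 e2) _.
rewrite mulrACA -/(m2 s j) ler_wpM2r ?(ltW (m2_gt0 s j)) //.
have e' : D%:R ^+ j * D%:R ^+ l * D%:R ^+ 2 = D%:R ^+ s * D%:R ^+ t0 :> R.
  by rewrite -!exprD hl.
have Y0 := mulr_gt0 (DR_gt0 j) (DR_gt0 l).
rewrite -invfM ler_pdivlMr ?(mulr_gt0 NR_gt0) // mulrC ler_pdivrMr //.
have -> : D%:R ^+ 3 * (D%:R ^+ j * D%:R ^+ l) = D%:R ^+ s * (D%:R ^+ t0 * D%:R) :> R.
  by rewrite [RHS]mulrA -e'; ring.
by rewrite mulrC ler_wpM2l ?(ltW (DR_gt0 s)).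
Qed.

Let b1 s j : R := B0 * 4^-1 ^+ s * m2 s j.

Let B0_gt0 : 0 < B0.
Proof. by rewrite /B0 divr_gt0 // mulr_gt0 // mulr_gt0 // DR_gt0. Qed.

Let b1_gt0 s j : 0 < b1 s j.
Proof. by rewrite /b1 mulr_gt0 // mulr_gt0 // exprn_gt0 // invr_gt0. Qed.

(** Cardinality times coefficient bound is B0 m2, without decay in s from the powers of D. The decay
    is the gain 1/n of [pnorm_Re_trigsum], whose (2q+2)-nd root is at most 4^-s by the choice of
    D. *)
Let block_norm s par j :
  \sum_(m < N) d s par j m ^+ (2 * q.+1) <= N%:R * b1 s j ^+ (2 * q.+1).
Proof.
have a0 : 0 <= A * D%:R ^+ 3 / (N%:R * D%:R ^+ s) * m2 s j.
  by rewrite ltW // mulr_gt0 // divr_gt0 // mulr_gt0 // DR_gt0.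
have inj : {in S s par j &, forall k l, (N %| freq k - freq l)%Z -> k = l}.
  by move=> k l /and4P[k0 _ _ _] /and4P[l0 _ _ _]; exact: freq_inj.
have := pnorm_Re_trigsum N_gt0 wN normw w_gap (ltn0Sn q) inj
   (@block_coef s par j) a0 (block_card s par j).
move/le_trans; apply; rewrite ler_wpM2l //.
set n : R := (13 * D ^ s)%:R; set al := A * D%:R ^+ 3 / (N%:R * D%:R ^+ s) * m2 s j.
have n0 : 0 < n by rewrite ltr0n muln_gt0 expn_gt0 (ltnW D_gt1).
have nD : n = 13 * D%:R ^+ s by rewrite /n natrM natrX.
have -> : n ^+ (2 * q.+1).-1 * al ^+ (2 * q.+1) = (n * al) ^+ (2 * q.+1) / n.
  have -> : (2 * q.+1 = (2 * q).+2)%N by lia.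
  by rewrite /= exprM_div // gt_eqF.
have -> : n * al = B0 * m2 s j.
  by rewrite nD /al /B0; field; rewrite !gt_eqF.
have -> : b1 s j = (B0 * m2 s j) * 4^-1 ^+ s by rewrite /b1; ring.
rewrite [leRHS]exprMn ler_wpM2l //.
  by rewrite exprn_ge0 // mulr_ge0 ?(ltW B0_gt0) ?(ltW (m2_gt0 _ _)).
rewrite -exprM mulnC exprM exprVn -natrX -DE exprVn lef_pV2 ?posrE //.
by rewrite nD -[leLHS]mul1r ler_wpM2r ?(ltW (DR_gt0 _)) //; lra.
Qed.

(** The squares of the b1 carry 16^-s, while summing m2 over j costs a logarithm linear in s,
    bounded crudely by 4^s. This leaves 4^-s for the square, hence 2^-s for the norm. *)
Let block_sum s par (T : nat) (L : R) : 1 <= u * v * N%:R -> 1 <= L ->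
  ln (u * v * N%:R) <= L ->
  \sum_(m < N) (\sum_(j < T) d s par j m) ^+ (2 * q.+1) <=
    N%:R * (2^-1 ^+ s *
      (Num.sqrt (1 + 3 * (2 ^ (2 * q.+1))%:R * (7 + 2 * ln D%:R)) * B0 * Num.sqrt L))
      ^+ (2 * q.+1).
Proof.
move=> uv L1 hL.
(* Blocks of parity [par] preceding such a j have index at most j - 2, hence frequencies below
   D^(j-1), and (2q+1) D^(j-1) < D^j. For the other parity the block itself is empty. *)
pose h j := if odd j == par then (D ^ j %/ D)%N else (D ^ j)%N.
(* A positive start for the induction in [lacunary_sum], small enough not to affect the order of the
   result. *)
pose eta : R := B0 ^+ 2 * 16^-1 ^+ s * L.
have L0 : 0 < L by exact: lt_le_trans L1.
have eta0 : 0 < eta.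
  by rewrite /eta mulr_gt0 // mulr_gt0 // exprn_gt0 // invr_gt0.
have := @lacunary_sum R N w q (d s par) h (b1 s) eta N_gt0 wN normw eta0 (b1_gt0 s) _ _
   (block_norm s par) T.
move=> H; apply: le_trans (H _ _) _.
- move=> i j ji; apply: (bandlimited_Re_trigsum N_gt0 wN normw) => k hk.
  have [/andP[_ h1] _ hp] := block_bounds hk.
  apply: ltnW; apply: leq_trans h1 _; rewrite /h; case: ifPn => [/eqP hi|_].
    have -> : (D ^ i = D ^ i.-1 * D)%N by rewrite -expnSr (ltn_predK ji).
    rewrite mulnK ?(ltnW D_gt1) // leq_exp2l //.
    case: i hi ji => // i /= hi ji; rewrite ltn_neqAle -ltnS ji andbT.
    by apply/eqP => e; move: hi; rewrite -e -hp; case: (odd j).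
  by rewrite leq_exp2l.
- move=> i f hf; case: (eqVneq (odd i) par) => hi; last first.
    rewrite big1 // => m _; rewrite /d /trigsum big1 ?mulr0 // => k.
    by move=> /block_bounds[_ _ e]; rewrite e eqxx in hi.
  rewrite /d; apply: (orth_Re_trigsum N_gt0 wN normw w_gap c hf) => k hk.
  have [/andP[h1 _] _ _] := block_bounds hk.
  apply: leq_trans h1; rewrite /h hi eqxx.
  have Di : (0 < D ^ i)%N by rewrite expn_gt0 (ltnW D_gt1).
  have := leq_divM (D ^ i) D; case: (_ %/ _)%N => [|x hx]; first by rewrite muln0.
  by apply: leq_trans hx; rewrite mulnC ltn_pmul2l.
rewrite ler_wpM2l //.
set K : R := (2 ^ (2 * q.+1))%:R; set c5 := 1 + _ * (7 + _).
have lnD : 0 <= ln D%:R :> R by rewrite ln_ge0 // ler1n ltnW.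
have K0 : 0 <= K by [].
have c50 : 0 <= c5 by rewrite /c5 addr_ge0 // !mulr_ge0 //; lra.
have -> : (2^-1 ^+ s * (Num.sqrt c5 * B0 * Num.sqrt L)) ^+ (2 * q.+1) =
   (4^-1 ^+ s * (c5 * B0 ^+ 2 * L)) ^+ q.+1.
  rewrite exprM; congr (_ ^+ _); rewrite !exprMn !sqr_sqrtr //; last lra.
  by rewrite -exprM mulnC exprM; congr (_ ^+ _ * _); field.
have sb : \sum_(i < T) b1 s i ^+ 2 <= B0 ^+ 2 * 16^-1 ^+ s * (L * ((7 + 2 * ln D%:R) * 4 ^+ s)).
  apply: (@le_trans _ _ (\sum_(i < T) B0 ^+ 2 * 16^-1 ^+ s * m2 s i)).
    apply: ler_sum => i _; rewrite /b1 exprMn [(B0 * _) ^+ 2]exprMn -exprM mulnC exprM.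
    have -> : 4^-1 ^+ 2 = 16^-1 :> R by field.
    rewrite ler_wpM2l //.
      by rewrite mulr_ge0 ?sqr_ge0 // exprn_ge0 // invr_ge0.
    (* Since m2 <= 1, its square may be replaced by m2 itself, whose sum is known. *)
    have := m2_gt0 s i; have : m2 s i <= 1.
      have mge t : 0 < t -> 0 <= Num.min 1 t :> R.
        by move=> t1; rewrite le_min ler01 ltW.
      have mle t : Num.min 1 t <= 1 :> R by rewrite ge_min lexx.
      by apply: mulr_ile1; rewrite ?mle // mge // ?divr_gt0 // !mulr_gt0.
    by move=> x1 x0; rewrite expr2 ler_piMr // ltW.
  have cc0 : 0 <= B0 ^+ 2 * 16^-1 ^+ s.
    by rewrite mulr_ge0 ?sqr_ge0 // exprn_ge0 // invr_ge0.
  rewrite -mulr_sumr ler_wpM2l //.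
  have xz : u * (v * N%:R * D%:R ^+ s) = (u * v * N%:R) * D%:R ^+ s by ring.
  have D1 : 1 <= D%:R ^+ s :> R by rewrite exprn_ege1 // ler1n ltnW.
  have z0 : 0 < v * N%:R * D%:R ^+ s by rewrite mulr_gt0 // mulr_gt0.
  have xz1 : 1 <= u * (v * N%:R * D%:R ^+ s) by rewrite xz -[leLHS]mul1r ler_pM.
  apply: le_trans (sum_min_min D_ge4 T u_gt0 z0 xz1) _.
  rewrite xz lnM ?posrE ?mulr_gt0 // lnXn ?ltr0n ?(ltnW D_gt1) // -[ln _ *+ s]mulr_natl.
  have s4 : s%:R <= 4 ^+ s :> R by rewrite -natrX ler_nat ltnW // ltn_expl.
  have s41 : 1 <= 4 ^+ s :> R by rewrite exprn_ege1 // ler1n.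
  apply: (@le_trans _ _ (L * (7 + 2 * (4 ^+ s * ln D%:R)))).
    have := ler_wpM2r lnD s4; set X := _ * ln _; set Y := _ * ln _ => XY.
    have Y0 : 0 <= Y by rewrite mulr_ge0 // exprn_ge0.
    nra.
  rewrite ler_wpM2l ?(le_trans ler01 L1) // mulrDl; nra.
apply: lerXn2r; rewrite ?nnegrE.
- rewrite addr_ge0 ?(ltW eta0) // mulr_ge0 ?mulr_ge0 //.
  by apply: sumr_ge0 => i _; exact: sqr_ge0.
- by rewrite mulr_ge0 ?exprn_ge0 ?invr_ge0 // mulr_ge0 ?(ltW L0) // mulr_ge0 ?sqr_ge0.
apply: (@le_trans _ _ (eta + 3 * K * (B0 ^+ 2 * 16^-1 ^+ s * (L * ((7 + 2 * ln D%:R) * 4 ^+ s))))).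
  by rewrite lerD2l ler_wpM2l // mulr_ge0.
rewrite /eta.
have -> : 16^-1 ^+ s = 4^-1 ^+ s * 4^-1 ^+ s :> R by rewrite -exprMn; congr (_ ^+ _); field.
have f1 : 4^-1 ^+ s * 4 ^+ s = 1 :> R by rewrite -exprMn mulVf ?expr1n ?pnatr_eq0.
have f2 : 4^-1 ^+ s <= 1 :> R by apply: exprn_ile1; rewrite ?invr_ge0 // invf_le1 ?ler1n.
have -> : B0 ^+ 2 * (4^-1 ^+ s * 4^-1 ^+ s) * L +
  3 * K * (B0 ^+ 2 * (4^-1 ^+ s * 4^-1 ^+ s) * (L * ((7 + 2 * ln D%:R) * 4 ^+ s))) =
  4^-1 ^+ s * (B0 ^+ 2 * L) *
    (4^-1 ^+ s + 3 * K * (7 + 2 * ln D%:R) * (4^-1 ^+ s * 4 ^+ s)) by ring.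
rewrite f1 mulr1.
have -> : 4^-1 ^+ s * (c5 * B0 ^+ 2 * L) = 4^-1 ^+ s * (B0 ^+ 2 * L) * c5 by ring.
rewrite ler_wpM2l ?lerD2r //; apply: mulr_ge0.
  by apply: exprn_ge0; rewrite invr_ge0.
by apply: mulr_ge0; [exact: sqr_ge0 | exact: ltW].
Qed.

Lemma trig_sum_mean_power (L : R) : 1 <= u * v * N%:R -> 1 <= L ->
  ln (u * v * N%:R) <= L ->
  \sum_(m < N) complex.Re (trigsum w (fun k : 'I_N => (0 < k)%N) c freq m) ^+ (2 * q.+1) <=
    N%:R * (square_function_const R q * (A / N%:R) * Num.sqrt L) ^+ (2 * q.+1).
Proof.
move=> uv L1 hL.
(* Any common bound for the block indices serves, as the estimates are uniform in T. *)
pose T := (3 * N + 4)%N.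
have tl x : (trunc_log D x <= x)%N.
  case: (posnP x) => [->|h]; first by rewrite trunc_log0.
  by apply: ltnW; apply: leq_trans (ltn_expl _ D_gt1) _; exact: trunc_logP.
have jjN k : (jj k <= N)%N.
  apply: leq_trans (tl _) _; apply: leq_trans (idist_bound (b * k) N_gt0).
  by rewrite leq_pmull.
have llN k : (ll k <= N)%N.
  apply: leq_trans (tl _) _; apply: leq_trans (idist_bound k N_gt0).
  by rewrite leq_pmull.
have jjT k : (jj k < T)%N by rewrite /T; have := jjN k; clear; lia.
have ssT k : (ss k < T)%N.
  have := jjN k; have := llN k; rewrite /ss /T; clear; lia.
pose f (i : 'I_T * bool) (m : nat) : R := \sum_(j < T) d i.1 i.2 j m.
have split m : complex.Re (trigsum w (fun k : 'I_N => (0 < k)%N) c freq m) = \sum_i f i m.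
  rewrite /f /d /trigsum.
  rewrite (partition_big (fun k : 'I_N => (Ordinal (ssT k%:Z), odd (jj k%:Z))) xpredT) //=.
  rewrite raddf_sum; apply: eq_bigr => -[s par] _.
  rewrite (partition_big (fun k : 'I_N => Ordinal (jjT k%:Z)) xpredT) //=.
  rewrite raddf_sum; apply: eq_bigr => j _; congr complex.Re.
  apply: eq_bigl => k; rewrite /S xpair_eqE -!val_eqE /=.
  case: (eqVneq (jj k) j) => [->|]; last by rewrite !andbF.
  by rewrite andbT.
pose B := Num.sqrt (1 + 3 * (2 ^ (2 * q.+1))%:R * (7 + 2 * ln D%:R)) * B0 * Num.sqrt L.
have lnD : 0 <= ln D%:R :> R by rewrite ln_ge0 // ler1n ltnW.
have K0 : 0 <= (2 ^ (2 * q.+1))%:R * (7 + 2 * ln D%:R) :> R by rewrite mulr_ge0 //; lra.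
have B_gt0 : 0 < B.
  by rewrite /B mulr_gt0 ?sqrtr_gt0 ?(lt_le_trans ltr01 L1) // mulr_gt0 ?sqrtr_gt0 //; lra.
(* Between different values of s or of the parity, no orthogonality is used: Minkowski's inequality
   suffices as the weights are summable. *)
pose cc (i : 'I_T * bool) : R := 2^-1 ^+ i.1.
have cc0 i : 0 < cc i by rewrite /cc exprn_gt0 // invr_gt0.
have hf i : \sum_(m < N) `|f i m| ^+ (2 * q).+2 <= N%:R * (cc i * B) ^+ (2 * q).+2.
  have e : (2 * q.+1 = (2 * q).+2)%N by rewrite mulnS.
  under eq_bigr do rewrite -e normrX_double.
  by rewrite -e; exact: block_sum.
have := mean_power_sum (index_enum _) B_gt0 cc0 hf.
have e : (2 * q.+1 = (2 * q).+2)%N by rewrite mulnS.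
rewrite -e; under eq_bigr do rewrite normrX_double.
under [in X in _ -> X <= _]eq_bigr do rewrite split.
move=> /le_trans; apply; rewrite ler_wpM2l //.
have sc n : \sum_(s < n) 2^-1 ^+ s = 2 - 2 * 2^-1 ^+ n :> R.
  elim: n => [|n IH]; first by rewrite big_ord0; lra.
  by rewrite big_ord_recr /= IH exprS; field.
have ccs : \sum_i cc i <= 4.
  rewrite -(pair_bigA _ (fun s par => 2^-1 ^+ (s : 'I_T))) /=.
  have e2 (x : R) : \sum_(par : bool) x = 2 * x by rewrite big_bool /=; ring.
  under eq_bigr do rewrite e2.
  rewrite -mulr_sumr sc; have : 0 <= 2^-1 ^+ T :> R by rewrite exprn_ge0 // invr_ge0.
  lra.
apply: lerXn2r; rewrite ?nnegrE.
- by rewrite mulr_ge0 ?(ltW B_gt0) // sumr_ge0 // => i _; exact: ltW.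
- rewrite mulr_ge0 ?sqrtr_ge0 // mulr_ge0 ?divr_ge0 ?(ltW A_gt0) //.
  by rewrite mulr_ge0 // mulr_ge0 ?sqrtr_ge0 // mulr_ge0 // exprn_ge0.
apply: (@le_trans _ _ (4 * B)); first by rewrite ler_wpM2r // ltW.
rewrite /square_function_const -DE /B /B0 le_eqVlt; apply/orP; left; apply/eqP.
by field; rewrite gt_eqF.
Qed.

End DyadicBlocks.

(** * A root of unity and its chords *)

Section RootOfUnity.
Variables (R : realType) (N : nat).
Hypothesis N_gt0 : (0 < N)%N.

Let cis (x : R) : R[i] := cos x +i* sin x.

Let cisD x y : cis (x + y) = cis x * cis y.
Proof.
rewrite /cis sinD cosD; apply/eqP; rewrite eq_complex /=.
by apply/andP; split; apply/eqP; ring.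
Qed.

Let cisX x n : cis x ^+ n = cis (n%:R * x).
Proof.
elim: n => [|n IH]; first by rewrite mul0r /cis cos0 sin0 expr0.
by rewrite exprS IH -cisD -[n.+1]add1n natrD mulrDl mul1r.
Qed.

Let norm_cis x : `|cis x| = 1.
Proof. by rewrite normc_def /= cos2Dsin2 sqrtr1. Qed.

Definition unity_root : R[i] := cis (pi *+ 2 / N%:R).

Lemma unity_rootX : unity_root ^+ N = 1.
Proof.
by rewrite cisX mulrCA divff ?mulr1 ?pnatr_eq0 -?lt0n // /cis cos2pi sin2pi.
Qed.

Lemma norm_unity_root : `|unity_root| = 1. Proof. exact: norm_cis. Qed.

(* Multiplying y by a suitable t brings the angle into [pi/2, pi], where the
   chord is at least 1; the chord of t y is at most t times that of y. *)
Lemma unity_root_gap (k : int) :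
  ((idist N k)%:R / N%:R)%:C <= `|unity_root ^ k - 1|.
Proof.
have [y hy yk] := idistP k N_gt0.
have w0 : unity_root != 0 by rewrite -normr_gt0 norm_unity_root ltr01.
have -> : `|unity_root ^ k - 1| = `|unity_root ^+ `|y| - 1|.
  have -> : unity_root ^ k = unity_root ^ y.
    by apply: (root_eqmod unity_rootX norm_unity_root).
  case: y {hy yk} => n; first by rewrite -exprnP.
  rewrite NegzE -exprnN /=; set z := unity_root ^+ n.+1.
  have z0 : z != 0 by rewrite expf_neq0.
  have -> : z^-1 - 1 = - z^-1 * (z - 1) by field.
  by rewrite normrM normrN normfV normrX norm_unity_root expr1n invr1 mul1r.
have := idist_bound k N_gt0; rewrite -yk; move: (`|y|%N) => x hx.
case: (posnP x) => [->|x0].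
  by rewrite mul0r subrr normr0.
pose t := (N %/ (2 * x))%N.
have t0 : (0 < t)%N by rewrite divn_gt0 ?muln_gt0 ?x0.
have tx1 : (2 * (t * x) <= N)%N by rewrite mulnCA leq_divM.
have tx2 : (N <= 4 * (t * x))%N.
  have := ltn_ceil N (_ : 0 < 2 * x)%N; rewrite -/t muln_gt0 x0 => /(_ isT); nia.
have chord : 1 <= `|unity_root ^+ (t * x) - 1|.
  rewrite cisX; set a := _%:R * _.
  have -> : cis a - 1 = (cos a - 1) +i* sin a.
    by apply/eqP; rewrite eq_complex /= oppr0 addr0 !eqxx.
  rewrite normc_def -[leLHS]/(1%:C) lecR -[leLHS]sqrtr1 /=; apply: ler_wsqrtr.
  have Npos : 0 < N%:R :> R by rewrite ltr0n.
  have aE : a = (2 * (t * x))%:R / N%:R * pi.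
    rewrite /a (natrM _ 2) -(mulr_natl pi); ring.
  have a1 : a <= pi.
    by rewrite aE ler_piMl ?pi_ge0 // ler_pdivrMr // mul1r ler_nat.
  have a2 : pi / 2 <= a.
    rewrite aE mulrC ler_wpM2r ?pi_ge0 // ler_pdivlMr // mulrC ler_pdivrMr //.
    by rewrite -natrM ler_nat; lia.
  have ca : cos a <= 0.
    have pi0 := pi_gt0 R.
    rewrite -(cos_pihalf R) leNgt ltr_cos ?in_itv /= -?leNgt //; apply/andP; split; lra.
  have := cos2Dsin2 a; move: (cos a) (sin a) ca => c s c0 h.
  have -> : (c - 1) ^+ 2 + s ^+ 2 = c ^+ 2 + s ^+ 2 + 1 - 2 * c by ring.
  by rewrite h; lra.
have geo : `|unity_root ^+ (t * x) - 1| <= t%:R * `|unity_root ^+ x - 1|.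
  rewrite mulnC exprM subrX1 normrM mulrC ler_wpM2r //.
  apply: le_trans (ler_norm_sum _ _ _) _.
  under eq_bigr do rewrite !normrX norm_unity_root !expr1n.
  by rewrite sumr_const card_ord.
have := le_trans chord geo; rewrite normc_def -[t%:R](rmorph_nat (real_complex R)) -rmorphM /=.
rewrite -[1]/(1%:C) !lecR; set z := Num.sqrt _ => h.
have z0 : 0 <= z by rewrite sqrtr_ge0.
rewrite ler_pdivrMr ?ltr0n //.
have : (x%:R : R) <= x%:R * (t%:R * z) by rewrite ler_peMr.
have : (t * x)%:R <= N%:R :> R by rewrite ler_nat; lia.
rewrite natrM; nra.
Qed.

End RootOfUnity.

(** * The discrete Fourier transform *)

Lemma sum_periodic (V : zmodType) (N : nat) (F : int -> V) (s : int) :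
  (forall j, F (j + N%:Z) = F j) ->
  \sum_(j < N) F (j%:Z + s) = \sum_(j < N) F j%:Z.
Proof.
move=> per.
have step t : \sum_(j < N) F (j%:Z + (t + 1)) = \sum_(j < N) F (j%:Z + t).
  case: N per => [|n] per; first by rewrite !big_ord0.
  rewrite big_ord_recr big_ord_recl /= addrC; congr (_ + _).
    by rewrite -(per (0 + t)); congr F; rewrite -addn1 PoszD; ring.
  by apply: eq_bigr => j _; congr F; rewrite /bump /= add1n -addn1 PoszD; ring.
elim: s => [|n IH|n IH].
- by under eq_bigr do rewrite addr0.
- by rewrite -IH -[n.+1]addn1 PoszD step.
- rewrite -IH -step; apply: eq_bigr => j _; congr (F (_ + _)).
  by rewrite -[n.+1]addn1 PoszD; ring.
Qed.

Section Dft.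
Variables (R : realType) (N : nat).
Hypothesis N_gt0 : (0 < N)%N.

Let w := unity_root R N.
Let wN : w ^+ N = 1. Proof. exact: unity_rootX. Qed.
Let normw : `|w| = 1. Proof. exact: norm_unity_root. Qed.
Let w_gap : forall k : int, ((idist N k)%:R / N%:R)%:C <= `|w ^ k - 1|.
Proof. exact: unity_root_gap. Qed.
Let wD := rootD normw.
Let NC0 : N%:R != 0 :> R[i]. Proof. by rewrite pnatr_eq0 -lt0n. Qed.

Definition dft (H : int -> R) (k : int) : R[i] :=
  N%:R^-1 * \sum_(j < N) (H j%:Z)%:C * w ^ (- (k * j%:Z)).

Lemma dft_inversion (H : int -> R) (j : int) : (forall i, H (i + N%:Z) = H i) ->
  (H j)%:C = \sum_(k < N) dft H k%:Z * w ^ (k%:Z * j).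
Proof.
move=> per.
have perM i n : H (i + n * N%:Z) = H i.
  elim: n => [|n IH|n IH]; first by rewrite mul0r addr0.
    by rewrite -[n.+1]addn1 PoszD mulrDl mul1r addrA per.
  by rewrite -{}IH -[LHS]per; congr H; rewrite -[n.+1]addn1 PoszD; ring.
under eq_bigr do rewrite /dft -mulrA mulr_suml.
rewrite -mulr_sumr exchange_big /=.
have E (i : 'I_N) : \sum_(k < N) (H i%:Z)%:C * w ^ (- (k%:Z * i%:Z)) * w ^ (k%:Z * j) =
    (H i%:Z)%:C * (if (N %| j - i%:Z)%Z then N%:R else 0).
  rewrite -(sum_root N_gt0 wN w_gap) mulr_sumr; apply: eq_bigr => k _.
  by rewrite -mulrA -wD; congr (_ * w ^ _); ring.
under eq_bigr do rewrite E.
have hj : 0 <= (j %% N)%Z by apply: modz_ge0; rewrite -lt0n.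
have hj2 : (`|(j %% N)%Z| < N)%N.
  by rewrite -ltz_nat gez0_abs // ltz_pmod.
rewrite (bigD1 (Ordinal hj2)) //= big1 ?addr0.
  rewrite ifT; last first.
    by rewrite gez0_abs // -eqz_mod_dvd modz_mod.
  rewrite mulrCA mulVf // mulr1; congr (_%:C).
  by rewrite gez0_abs // {1}(divz_eq j N) addrC perM.
move=> i hi; rewrite ifN ?mulr0 //; apply: contra hi.
rewrite -eqz_mod_dvd (modz_small (m := i)) ?ltz_nat ?ltn_ord //.
by move=> /eqP e; apply/eqP/val_inj; rewrite /= e.
Qed.

Lemma norm_dft_le (H : int -> R) k :
  `|dft H k| <= (N%:R^-1 * \sum_(j < N) `|H j%:Z|)%:C.
Proof.
rewrite rmorphM /= fmorphV /= rmorph_nat /dft normrM normfV normr_nat.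
rewrite ler_wpM2l ?invr_ge0 //; apply: le_trans (ler_norm_sum _ _ _) _.
rewrite rmorph_sum /=; apply: ler_sum => j _.
by rewrite normrM (norm_root normw) mulr1 normc_def /= expr0n /= addr0 sqrtr_sqr.
Qed.

Definition fdiff (H : int -> R) (j : int) : R := H (j + 1) - H j.

Lemma dft_fdiff H k : (forall i, H (i + N%:Z) = H i) ->
  dft (fdiff H) k = (w ^ k - 1) * dft H k.
Proof.
move=> per; rewrite /dft mulrCA; congr (_ * _).
under eq_bigr do rewrite /fdiff rmorphB /= mulrBl.
rewrite sumrB mulrBl mul1r; congr (_ - _).
rewrite -(@sum_periodic _ N (fun j => (H j)%:C * w ^ (- (k * j))) 1).
  rewrite mulr_sumr; apply: eq_bigr => j _.
  by rewrite mulrCA -wD; congr (_ * w ^ _); ring.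
move=> j; rewrite per; congr (_ * _).
apply: (root_eqmod wN normw).
by apply/dvdzP; exists (- k); ring.
Qed.

(** Summation by parts: each difference multiplies the coefficient at k by w^k - 1, of modulus at
    least ||k|| / N. *)
Lemma norm_dft_decay (H : int -> R) r (B : R) (k : int) :
  (forall i, H (i + N%:Z) = H i) -> ~~ (N %| k)%Z ->
  N%:R^-1 * \sum_(j < N) `|iter r fdiff H j%:Z| <= B / N%:R ^+ r ->
  `|dft H k| <= (B * (idist N k)%:R^-1 ^+ r)%:C.
Proof.
move=> per hk hB.
have per' n i : iter n fdiff H (i + N%:Z) = iter n fdiff H i.
  by elim: n i => // n IH i /=; rewrite /fdiff addrAC !IH.
have E : dft (iter r fdiff H) k = (w ^ k - 1) ^+ r * dft H k.
  elim: r {hB} => [|n IH]; first by rewrite mul1r.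
  by rewrite /= dft_fdiff // IH exprS mulrA.
have := le_trans (norm_dft_le (iter r fdiff H) k) (_ : _ <= (B / N%:R ^+ r)%:C).
rewrite lecR => /(_ hB); rewrite E normrM normrX.
have x0 : (0 < idist N k)%N by rewrite lt0n idist_eq0.
have xR : 0 < (idist N k)%:R :> R by rewrite ltr0n.
have NR : 0 < N%:R :> R by rewrite ltr0n.
rewrite (_ : B * (idist N k)%:R^-1 ^+ r =
  (B / N%:R ^+ r) * ((idist N k)%:R / N%:R) ^- r); last first.
  by rewrite expr_div_n exprVn; field; rewrite !expf_neq0 ?gt_eqF.
set y := (idist N k)%:R / N%:R; have y0 : 0 < y by rewrite divr_gt0.
set Z := B / N%:R ^+ r.
rewrite (rmorphM _ Z) /= [(y ^- r)%:C]fmorphV /= rmorphXn /= => h.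
rewrite ler_pdivlMr ?exprn_gt0 ?ltcR // mulrC.
apply: le_trans h; rewrite ler_wpM2r // lerXn2r ?nnegrE ?ler0c ?(ltW y0) //.
  by case: (w ^ k - 1) => a c; exact: sqrtr_ge0.
by rewrite /y; exact: w_gap.
Qed.

(** Along the lattice, the frequency k of the second factor meets only the frequency - b k of the
    first. The translation by m is a mere character, which makes the error a trigonometric sum in
    m. *)
Lemma lattice_convolution (H1 H2 : int -> R) (b m : int) :
  (forall i, H1 (i + N%:Z) = H1 i) -> (forall i, H2 (i + N%:Z) = H2 i) ->
  (N%:R^-1 * \sum_(mu < N) H1 (mu%:Z - m) * H2 (b * mu%:Z))%:C =
  \sum_(k < N) dft H2 k%:Z * dft H1 (- (b * k%:Z)) * w ^ (b * k%:Z * m).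
Proof.
move=> per1 per2; rewrite rmorphM /= fmorphV rmorph_nat rmorph_sum /=.
under eq_bigr do rewrite rmorphM /= (dft_inversion _ per2) mulr_sumr.
rewrite exchange_big mulr_sumr /=; apply: eq_bigr => k _.
pose F j := (H1 j)%:C * w ^ (b * k%:Z * j).
have FN j : F (j + N%:Z) = F j.
  rewrite /F per1; congr (_ * _); apply: (root_eqmod wN normw).
  by apply/dvdzP; exists (b * k%:Z); ring.
have -> : dft H1 (- (b * k%:Z)) = N%:R^-1 * \sum_(j < N) F j%:Z.
  by congr (_ * _); apply: eq_bigr => j _; congr (_ * w ^ _); ring.
rewrite -(sum_periodic (- m) FN) [RHS]mulrAC [RHS]mulrCA; congr (_ * _).
rewrite mulr_sumr; apply: eq_bigr => mu _; rewrite /F.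
have -> : k%:Z * (b * mu%:Z) = b * k%:Z * m + b * k%:Z * (mu%:Z - m) by ring.
by rewrite wD; ring.
Qed.

End Dft.

(** The leading 2 stems from Minkowski's inequality, the zero frequency and the others sharing one
    bound; 3^r stems from r uses of ||k|| ||b k|| >= N / 3. *)
Definition lattice_error_const (R : realType) (q r : nat) (B : R) : R :=
  2 * (B + square_function_const R q * (B ^+ 2 * 3 ^+ r)).

Lemma square_function_const_ge0 (R : realType) q : 0 <= square_function_const R q.
Proof. by rewrite /square_function_const !mulr_ge0 ?sqrtr_ge0 ?exprn_ge0. Qed.

Lemma lattice_error_const_gt0 (R : realType) q r (B : R) : 0 < B ->
  0 < lattice_error_const q r B.
Proof.
move=> B0; have s0 := square_function_const_ge0 R q.
rewrite /lattice_error_const mulr_gt0 // ltr_pwDl //.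
by apply: mulr_ge0 => //; apply: mulr_ge0; apply: exprn_ge0 => //; exact: ltW.
Qed.

Lemma norm_dft_min (R : realType) (N r : nat) (B u : R) (H : int -> R) (k : int) :
  (0 < N)%N -> 0 < B -> 0 < u ->
  (forall i, H (i + N%:Z) = H i) -> ~~ (N %| k)%Z ->
  N%:R^-1 * \sum_(j < N) `|H j%:Z| <= B * u ^+ r ->
  N%:R^-1 * \sum_(j < N) `|iter r (@fdiff R) H j%:Z| <= B / N%:R ^+ r ->
  `|dft N H k| <= (B * Num.min u (idist N k)%:R^-1 ^+ r)%:C.
Proof.
move=> N0 B0 u0 per hk h1 h2; case: (leP u (idist N k)%:R^-1) => _.
  by apply: le_trans (norm_dft_le N H k) _; rewrite lecR.
exact: norm_dft_decay.
Qed.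

Lemma lattice_error_mean_power (R : realType) (q r n : nat) (B u v I L : R)
    (H1 H2 : int -> R) : (0 < n)%N -> let N := fibn n in
  0 < B -> 0 < u -> 0 < v ->
  (forall i, H1 (i + N%:Z) = H1 i) -> (forall i, H2 (i + N%:Z) = H2 i) ->
  N%:R^-1 * \sum_(j < N) `|H1 j%:Z| <= B * u ^+ r.+1 ->
  N%:R^-1 * \sum_(j < N) `|H2 j%:Z| <= B * v ^+ r.+1 ->
  N%:R^-1 * \sum_(j < N) `|iter r.+1 (@fdiff R) H1 j%:Z| <= B / N%:R ^+ r.+1 ->
  N%:R^-1 * \sum_(j < N) `|iter r.+1 (@fdiff R) H2 j%:Z| <= B / N%:R ^+ r.+1 ->
  1 <= u * v * N%:R -> 1 <= L -> ln (u * v * N%:R) <= L ->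
  `|I - (N%:R^-1 * \sum_(j < N) H1 j%:Z) * (N%:R^-1 * \sum_(j < N) H2 j%:Z)|
     <= B / N%:R ^+ r.+1 ->
  \sum_(m < N) (I - N%:R^-1 * \sum_(mu < N) H1 (mu%:Z - m%:Z) *
                    H2 ((fibn n.-1)%:Z * mu%:Z)) ^+ (2 * q.+1) <=
   N%:R * (lattice_error_const q r B * Num.sqrt L / N%:R ^+ r.+1) ^+ (2 * q.+1).
Proof.
move=> n0 N B0 u0 v0 per1 per2 a1 a2 d1 d2 uv L1 hL hI.
have N0 : (0 < N)%N by apply: fibn_gt0.
have NR : 0 < N%:R :> R by rewrite ltr0n.
set b : int := (fibn n.-1)%:Z.
have hN (k : int) : ~~ (N %| k)%Z -> (N <= 3 * (idist N k * idist N (b * k)))%N.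
  exact: fib_dist_mul.
have not_dvd (k : 'I_N) : (0 < k)%N -> ~~ (N %| k%:Z)%Z.
  move=> k0; rewrite -[(_ \in _)]/((N %| k)%N); apply/negP => /dvdn_leq -/(_ k0).
  by rewrite leqNgt ltn_ord.
have sqL : 1 <= Num.sqrt L by rewrite -[1]sqrtr1 ler_wsqrtr.
pose c (k : 'I_N) : R[i] := - (dft N H2 k%:Z * dft N H1 (- (b * k%:Z))).
(* Of the r + 1 powers of the product of minima, r are bounded by 3 / N and go into A; the last one
   is kept for the blocks. *)
pose A : R := B ^+ 2 * 3 ^+ r / N%:R ^+ r.
have A0 : 0 < A by rewrite /A divr_gt0 ?mulr_gt0 ?exprn_gt0.
have cA (k : 'I_N) : (0 < k)%N ->
  `|c k| <= (A * (Num.min u (idist N (b * k%:Z))%:R^-1 *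
                  Num.min v (idist N k%:Z)%:R^-1))%:C.
  move=> k0; have hk := not_dvd _ k0.
  have hx := hN _ hk.
  have hbk : ~~ (N %| - (b * k%:Z))%Z.
    rewrite -idist_eq0 // idistN //; apply/negP => /eqP e.
    by move: hx; rewrite e !muln0 leqn0; case: (N) N0.
  rewrite /c normrN normrM.
  have h2 := norm_dft_min N0 B0 v0 per2 hk a2 d2.
  have h1 := norm_dft_min N0 B0 u0 per1 hbk a1 d1; rewrite idistN // in h1.
  apply: le_trans (ler_pM _ _ h2 h1) _ => //; rewrite -rmorphM /= lecR.
  have x0 : 0 < (idist N (b * k%:Z))%:R :> R.
    by rewrite ltr0n lt0n; apply/negP => /eqP e; move: hx; rewrite e !muln0 leqn0; case: (N) N0.
  have y0 : 0 < (idist N k%:Z)%:R :> R by rewrite ltr0n lt0n idist_eq0.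
  have hxy : N%:R <= 3 * ((idist N (b * k%:Z))%:R * (idist N k%:Z)%:R) :> R.
    by rewrite -!natrM ler_nat [(idist _ (b * _) * _)%N]mulnC.
  move: (idist N (b * _))%:R (idist N k%:Z)%:R x0 y0 hxy => x y x0 y0 hxy.
  have mu0 : 0 <= Num.min u x^-1 by rewrite le_min (ltW u0) invr_ge0 ltW.
  have mv0 : 0 <= Num.min v y^-1 by rewrite le_min (ltW v0) invr_ge0 ltW.
  have mm : Num.min u x^-1 * Num.min v y^-1 <= 3 / N%:R.
    apply: (@le_trans _ _ (x^-1 * y^-1)).
      by apply: ler_pM => //; rewrite ge_min lexx orbT.
    rewrite -invfM ler_pdivlMr // mulrC ler_pdivrMr ?mulr_gt0 //.
  move: (Num.min u _) (Num.min v _) mu0 mv0 mm => mu mv mu0 mv0 mm.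
  have -> : B * mv ^+ r.+1 * (B * mu ^+ r.+1) = B ^+ 2 * (mu * mv) ^+ r * (mu * mv).
    by rewrite !exprS exprMn expr0; ring.
  rewrite ler_wpM2r ?mulr_ge0 // /A -mulrA ler_wpM2l ?sqr_ge0 // -expr_div_n.
  by apply: lerXn2r; rewrite ?nnegrE ?mulr_ge0 ?invr_ge0.
pose g (m : nat) : R := complex.Re (trigsum (unity_root R N)
   (fun k : 'I_N => (0 < k)%N) c (fun k => b * k%:Z) m).
have hg : \sum_(m < N) `|g m| ^+ (2 * q).+2 <=
    N%:R * (square_function_const R q * (A / N%:R) * Num.sqrt L) ^+ (2 * q).+2.
  have := trig_sum_mean_power (q := q) N0 (unity_rootX R N0) (norm_unity_root R N)
    (unity_root_gap R N0) hN A0 u0 v0 cA erefl uv L1 hL.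
  have -> : (2 * q.+1 = (2 * q).+2)%N by rewrite mulnS.
  apply: le_trans; rewrite le_eqVlt; apply/orP; left; apply/eqP.
  apply: eq_bigr => m _; have e : ((2 * q).+2 = 2 * q.+1)%N by rewrite mulnS.
  by rewrite e normrX_double.
pose m0 (H : int -> R) : R := N%:R^-1 * \sum_(j < N) H j%:Z.
(* At k = 0 the coefficients are the two means, whose product is compared with I. The left side is
   real, so the other frequencies enter through their real part. *)
have split (m : nat) : I - N%:R^-1 * \sum_(mu < N) H1 (mu%:Z - m%:Z) * H2 (b * mu%:Z)
    = (I - m0 H1 * m0 H2) + g m.
  have dft0 H : dft N H 0 = (m0 H)%:C.
    rewrite /dft rmorphM /= fmorphV rmorph_nat rmorph_sum /=; congr (_ * _).
    by apply: eq_bigr => j _; rewrite mul0r oppr0 expr0z mulr1.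
  set X := LHS; have : X%:C = (I - m0 H1 * m0 H2)%:C +
     trigsum (unity_root R N) (fun k : 'I_N => (0 < k)%N) c (fun k => b * k%:Z) m.
    rewrite /X rmorphB /= lattice_convolution // (bigD1 (Ordinal N0)) //= !mulr0 oppr0 !dft0.
    rewrite mul0r expr0z mulr1 rmorphB /= -addrA; congr (_ + _).
    have -> : (m0 H1 * m0 H2)%:C = (m0 H2)%:C * (m0 H1)%:C by rewrite mulrC; exact: rmorphM.
    rewrite opprD; congr (_ + _).
    rewrite /trigsum -sumrN; apply: eq_big => [k|k _]; last by rewrite /c mulNr.
    by rewrite -val_eqE /= lt0n.
  by rewrite /g; case: (trigsum _ _ _ _ _) => x y [].
have sqc := square_function_const_ge0 R q.
have B3 : 0 <= B ^+ 2 * 3 ^+ r by rewrite mulr_ge0 ?sqr_ge0 ?exprn_ge0.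
pose M : R := (B + square_function_const R q * (B ^+ 2 * 3 ^+ r)) * Num.sqrt L / N%:R ^+ r.+1.
have M0 : 0 < M.
  rewrite /M divr_gt0 ?exprn_gt0 // mulr_gt0 // ?(lt_le_trans ltr01 sqL) //.
  by rewrite ltr_pwDl // mulr_ge0.
pose f (i : bool) (m : nat) := if i then I - m0 H1 * m0 H2 else g m.
have NX k : 0 < N%:R ^+ k :> R by rewrite exprn_gt0.
have hf i : \sum_(m < N) `|f i m| ^+ (2 * q).+2 <= N%:R * (1 * M) ^+ (2 * q).+2.
  rewrite mul1r; case: i; rewrite /f.
    rewrite sumr_const card_ord -[leLHS]mulr_natl ler_wpM2l // lerXn2r ?nnegrE ?(ltW M0) //.
    apply: le_trans hI _; rewrite /M ler_wpM2r ?invr_ge0 ?(ltW (NX _)) //.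
    rewrite -[leLHS]mulr1 ler_pM ?(ltW B0) // lerDl.
    by rewrite mulr_ge0.
  apply: le_trans hg _; rewrite ler_wpM2l //; apply: lerXn2r; rewrite ?nnegrE ?(ltW M0) //.
    by rewrite mulr_ge0 ?sqrtr_ge0 // mulr_ge0 // divr_ge0 // ltW.
  have -> : square_function_const R q * (A / N%:R) * Num.sqrt L =
     square_function_const R q * (B ^+ 2 * 3 ^+ r) * Num.sqrt L / N%:R ^+ r.+1.
    rewrite /A (exprSr _ r); move: (square_function_const _ _) (NX r) => K.
    by move: (N%:R ^+ r) (3 ^+ r) => x y x0; field; rewrite !gt_eqF.
  rewrite /M ler_wpM2r ?invr_ge0 ?(ltW (NX _)) // ler_wpM2r ?(le_trans ler01 sqL) //.
  by rewrite lerDr ltW.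
have := mean_power_sum [:: true; false] M0 (fun=> ltr01) hf.
rewrite !big_cons big_nil /=.
under eq_bigr do rewrite !big_cons big_nil addr0 /f -split.
have -> : (2 * q).+2 = (2 * q.+1)%N by rewrite mulnS.
under eq_bigr do rewrite normrX_double.
move/le_trans; apply; rewrite le_eqVlt; apply/orP; left; apply/eqP.
congr (_ * _ ^+ _); rewrite /lattice_error_const /M; ring.
Qed.

Local Close Scope complex_scope.

(** * Periodic splines *)

Section CentralDifference.
Variable R : realType.
Implicit Types (f g : R -> R) (u x : R) (p : {poly R}).

Definition cdiff u f x := f (x + u / 2) - f (x - u / 2).

Lemma iter_cdiff_eq k u f g x : 0 < u ->
  (forall y, `|y - x| <= k%:R * u / 2 -> f y = g y) ->
  iter k (cdiff u) f x = iter k (cdiff u) g x.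
Proof.
move=> u0; elim: k x => [|k IH] x h.
  by apply: h; rewrite subrr normr0 !mul0r.
have hk : k.+1%:R * u / 2 = k%:R * u / 2 + u / 2 by rewrite -addn1 natrD; field.
by rewrite /= /cdiff !IH // => y hy; apply: h; rewrite hk;
  move: hy; rewrite !ler_norml => /andP[h1 h2]; apply/andP; split; lra.
Qed.

Lemma eq_iter_cdiff k u f g : f =1 g -> iter k (cdiff u) f =1 iter k (cdiff u) g.
Proof. by move=> fg; elim: k => // k IH x; rewrite /= /cdiff !IH. Qed.

Lemma iter_cdiff_shift k u f c x :
  iter k (cdiff u) (fun y => f (y + c)) x = iter k (cdiff u) f (x + c).
Proof.
by elim: k x => // k IH x; rewrite /= /cdiff !IH [x + _ + c]addrAC [x - _ + c]addrAC.
Qed.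

Lemma iter_cdiffB k u f g x :
  iter k (cdiff u) (fun y => f y - g y) x = iter k (cdiff u) f x - iter k (cdiff u) g x.
Proof. by elim: k x => // k IH x; rewrite /= /cdiff !IH; ring. Qed.

Lemma iter_cdiffZ k u c f x :
  iter k (cdiff u) (fun y => c * f y) x = c * iter k (cdiff u) f x.
Proof. by elim: k x => // k IH x; rewrite /= /cdiff !IH; ring. Qed.

Lemma iter_cdiff_sum k u n (F : nat -> R -> R) x :
  iter k (cdiff u) (fun y => \sum_(i < n) F i y) x = \sum_(i < n) iter k (cdiff u) (F i) x.
Proof. by elim: k x => // k IH x; rewrite /= /cdiff !IH sumrB. Qed.

Lemma iter_cdiff_scale k u c f x :
  iter k (cdiff u) (fun y => f (c * y)) x = iter k (cdiff (c * u)) f (c * x).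
Proof.
by elim: k x => // k IH x; rewrite /= /cdiff !IH mulrDr mulrBr !mulrA.
Qed.

Lemma iter_cdiff_cst k u (c : R) x : iter k.+1 (cdiff u) (fun=> c) x = 0.
Proof. by elim: k x => [|k IH] x; [rewrite /= /cdiff subrr | rewrite iterS /cdiff !IH subrr]. Qed.

Lemma cdiffC u v f x : cdiff u (cdiff v f) x = cdiff v (cdiff u f) x.
Proof.
rewrite /cdiff.
have -> : x + u / 2 + v / 2 = x + v / 2 + u / 2 by ring.
have -> : x + u / 2 - v / 2 = x - v / 2 + u / 2 by ring.
have -> : x - u / 2 + v / 2 = x + v / 2 - u / 2 by ring.
have -> : x - u / 2 - v / 2 = x - v / 2 - u / 2 by ring.
ring.
Qed.

Lemma cdiff_iterC k u v f x :
  cdiff u (iter k (cdiff v) f) x = iter k (cdiff v) (cdiff u f) x.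
Proof.
by elim: k x => // k IH x; rewrite iterS cdiffC /= /cdiff -!IH.
Qed.

Lemma iter_cdiffC k l u v f x :
  iter k (cdiff u) (iter l (cdiff v) f) x = iter l (cdiff v) (iter k (cdiff u) f) x.
Proof.
elim: k x => // k IH x; rewrite iterS.
rewrite -[RHS]cdiff_iterC.
by rewrite /cdiff !IH.
Qed.

Lemma iter_cdiff_bound k u f (B : R) : (forall x, `|f x| <= B) ->
  forall x, `|iter k (cdiff u) f x| <= 2 ^+ k * B.
Proof.
move=> h; elim: k => [|k IH] x; first by rewrite mul1r.
rewrite /= /cdiff exprS; apply: le_trans (ler_normB _ _) _.
have := IH (x + u / 2); have := IH (x - u / 2); lra.
Qed.

Lemma iter_cdiff_sum_bound k u f (B d : R) N :
  (forall x, \sum_(j < N) `|f (x + j%:R * d)| <= B) ->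
  forall x, \sum_(j < N) `|iter k (cdiff u) f (x + j%:R * d)| <= 2 ^+ k * B.
Proof.
move=> h; elim: k => [|k IH] x; first by rewrite mul1r.
apply: (@le_trans _ _ (\sum_(j < N) (`|iter k (cdiff u) f (x + u / 2 + j%:R * d)| +
   `|iter k (cdiff u) f (x - u / 2 + j%:R * d)|))).
  apply: ler_sum => j _; rewrite /= /cdiff.
  by rewrite [x + _ + _]addrAC [x - _ + _]addrAC ler_normB.
rewrite big_split exprS /=.
have := IH (x + u / 2); have := IH (x - u / 2); lra.
Qed.

Lemma cdiff_poly k u p : (size p <= k.+2)%N ->
  exists q : {poly R}, [/\ forall x, cdiff u (horner p) x = q.[x],
    (size q <= k.+1)%N & q`_k = k.+1%:R * p`_k.+1 * u].
Proof.
move=> sp.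
pose e i : R := (u / 2) ^+ i - (- (u / 2)) ^+ i.
exists (\sum_(i < size p) e i *: p^`N(i)).
have e0 : e 0%N = 0 by rewrite /e !expr0 subrr.
have e1 : e 1%N = u by rewrite /e !expr1; field.
have co j : (\sum_(i < size p) e i *: p^`N(i))`_j =
    \sum_(i < size p) e i * (p`_(i + j) *+ 'C(i + j, i)).
  by rewrite coef_sum; apply: eq_bigr => i _; rewrite coefZ coef_nderivn.
split.
- move=> x; rewrite /cdiff !nderiv_taylor; try exact: mulrC.
  rewrite horner_sum -sumrB; apply: eq_bigr => i _.
  by rewrite hornerZ /e; ring.
- apply/leq_sizeP => j hj; rewrite co big1 // => i _.
  case: (posnP i) => [->|i0]; first by rewrite e0 mul0r.
  rewrite nth_default ?mul0rn ?mulr0 //; apply: leq_trans sp _.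
  by have -> : (k.+2 = 1 + k.+1)%N by []; apply: leq_add.
- rewrite co.
  have z (i : nat) : (1 < i)%N -> p`_(i + k) = 0.
    move=> i1; rewrite nth_default //; apply: leq_trans sp _.
    by have -> : (k.+2 = 2 + k)%N by []; rewrite leq_add2r.
  case: (leqP (size p) 1) => s1.
    rewrite [p`_k.+1]nth_default ?mulr0 ?mul0r; last exact: leq_trans s1 _.
    rewrite big1 // => i _; have : (i < 1)%N by apply: leq_trans (ltn_ord i) s1.
    by case: (nat_of_ord i) => // _; rewrite e0 mul0r.
  rewrite (bigD1 (Ordinal s1)) //= big1 ?addr0.
    by rewrite e1 add1n bin1 -mulr_natl; ring.
  move=> i hi; case: i hi => -[|[|i]] hi //= hi'; first by rewrite e0 mul0r.
  by rewrite z // mul0rn mulr0.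
Qed.

Lemma iter_cdiff_poly k u p x : (size p <= k.+1)%N ->
  iter k (cdiff u) (horner p) x = k`!%:R * p`_k * u ^+ k.
Proof.
elim: k p x => [|k IH] p x sp.
  by rewrite /= (size1_polyC sp) hornerC coefC fact0 mul1r mulr1.
have [q [hq sq cq]] := cdiff_poly u sp.
rewrite iterSr (eq_iter_cdiff _ _ hq) IH // cq factS natrM exprS; ring.
Qed.

Lemma cdiff_surj s (f : {poly R}) : (size f <= s)%N ->
  exists2 p : {poly R}, (size p <= s.+1)%N & forall x, cdiff 1 (horner p) x = f.[x].
Proof.
elim: s f => [|s IH] f sf.
  exists 0; rewrite ?size_poly0 // => x.
  by move: sf; rewrite leqn0 size_poly_eq0 => /eqP ->; rewrite /cdiff !horner0 subrr.
pose p0 : {poly R} := (f`_s / s.+1%:R) *: 'X^(s.+1).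
have sp0 : (size p0 <= s.+2)%N by rewrite (leq_trans (size_scale_leq _ _)) ?size_polyXn.
have [q [hq sq cq]] := cdiff_poly 1 sp0.
have qs : q`_s = f`_s.
  by rewrite cq coefZ coefXn eqxx mulr1 mulr1 mulrCA divff ?mulr1 // pnatr_eq0.
have [|p sp hp] := IH (f - q).
  apply/leq_sizeP => j; rewrite leq_eqVlt => /orP[/eqP <-|sj].
    by rewrite coefB qs subrr.
  by rewrite coefB !nth_default ?subr0 //; [exact: leq_trans sq sj | exact: leq_trans sf sj].
exists (p + p0).
  by rewrite (leq_trans (size_polyD _ _)) // geq_max sp0 andbT (leq_trans sp).
move=> x; have := hp x; have := hq x; rewrite /cdiff !(hornerD, hornerN) => h1 h2.
by rewrite -[RHS](subrK q.[x]) -h2 -h1; ring.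
Qed.

End CentralDifference.

Lemma sum_ord_mul (V : nmodType) (a N : nat) (F : nat -> V) :
  \sum_(i < a * N) F i = \sum_(j < N) \sum_(i < a) F (i * N + j)%N.
Proof.
elim: a => [|a IH].
  by rewrite mul0n big_ord0 big1 // => j _; rewrite big_ord0.
rewrite mulSn addnC big_split_ord /= IH -big_split; apply: eq_bigr => j _ /=.
by rewrite big_ord_recr.
Qed.

Section PeriodicSpline.
Variables (R : realType) (r : nat).
Implicit Types (u x y : R).

(** For k = 0 the value at 0 is 1, so that its difference is the indicator of a half-open interval,
    closed on the left as in [hfun]. *)
Definition tpow (k : nat) x : R := if 0 <= x then x ^+ k / k`!%:R else 0.

(** The B-spline h^(r+1)_u, of degree r (see [hfunE]). *)
Definition spline u : R -> R := iter r.+1 (cdiff u) (tpow r).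

Let mono : {poly R} := r`!%:R^-1 *: 'X^r.

Lemma tpow_ge0 x : 0 <= x -> tpow r x = mono.[x].
Proof. by move=> x0; rewrite /tpow x0 hornerZ hornerXn mulrC. Qed.

Lemma tpow_lt0 x : x < 0 -> tpow r x = 0.
Proof. by move=> x0; rewrite /tpow leNgt x0. Qed.

(** To the right, r + 1 differences annihilate a polynomial of degree r; to the left, the truncated
    power is 0. *)
Lemma spline_support u x : 0 < u -> r.+1%:R * u / 2 < `|x| -> spline u x = 0.
Proof.
move=> u0; rewrite ltr_normr => /orP[] hx.
  rewrite /spline (@iter_cdiff_eq _ _ _ _ (horner mono)) // => [|y hy].
    rewrite iter_cdiff_poly; last first.
      by rewrite (leq_trans (size_scale_leq _ _)) ?size_polyXn.
    by rewrite coefZ coefXn gtn_eqF // !mulr0 mul0r.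
  apply: tpow_ge0; move: hy; rewrite ler_norml; lra.
rewrite /spline (@iter_cdiff_eq _ _ _ _ (fun=> 0)) // => [|y hy].
  by rewrite iter_cdiff_cst.
apply: tpow_lt0; move: hy; rewrite ler_norml; lra.
Qed.

(* A primitive of x^r/r! for the unit difference: up to a constant, the
   Bernoulli polynomial of degree r + 1 divided by (r + 1)!. *)
Lemma exists_bernoulli : exists p : {poly R},
  (size p <= r.+2)%N /\ forall x, p.[x + 1] - p.[x] = x ^+ r / r`!%:R.
Proof.
have [|p sp hp] := @cdiff_surj R r.+1 (mono \Po ('X - (2^-1)%:P)).
  rewrite (leq_trans (size_comp_poly_leq _ _)) // size_XsubC muln1 ltnS.
  have : (size mono <= r.+1)%N by rewrite (leq_trans (size_scale_leq _ _)) ?size_polyXn.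
  by case: (size mono).
exists p; split=> // x; have := hp (x + 2^-1); rewrite /cdiff horner_comp.
rewrite hornerXsubC hornerZ hornerXn.
have -> : x + 2^-1 + 1 / 2 = x + 1 by field.
have -> : x + 2^-1 - 1 / 2 = x by field.
by move=> ->; rewrite addrK mulrC.
Qed.

Definition bernoulli : {poly R} := sval (cid exists_bernoulli).

Lemma size_bernoulli : (size bernoulli <= r.+2)%N.
Proof. by rewrite /bernoulli; case: cid => ? []. Qed.

Lemma bernoulliD1 x : bernoulli.[x + 1] - bernoulli.[x] = x ^+ r / r`!%:R.
Proof. by rewrite /bernoulli; case: cid => ? []. Qed.

Lemma iter_cdiff_bernoulli u x : iter r.+1 (cdiff u) (horner bernoulli) x = u ^+ r.+1.
Proof.
rewrite iter_cdiff_poly ?size_bernoulli //.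
suff -> : r.+1`!%:R * bernoulli`_r.+1 = 1 by rewrite mul1r.
(* The leading coefficient is read off from unit differences: the first gives a translate of x^r/r!,
   r more give 1. *)
have := @iter_cdiff_poly R r.+1 1 bernoulli 0 (size_bernoulli).
rewrite expr1n mulr1 => <-.
rewrite iterSr (@eq_iter_cdiff _ _ _ _ (fun x => mono.[x - 2^-1])) => [|y].
  rewrite (iter_cdiff_shift _ _ (horner mono)) iter_cdiff_poly; last first.
    by rewrite (leq_trans (size_scale_leq _ _)) ?size_polyXn.
  by rewrite coefZ coefXn eqxx mulr1 expr1n mulr1 divff // pnatr_eq0 -lt0n fact_gt0.
rewrite /cdiff.
have -> : y + 1 / 2 = (y - 2^-1) + 1 by field.
have -> : y - 1 / 2 = y - 2^-1 by field.
by rewrite bernoulliD1 hornerZ hornerXn mulrC.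
Qed.

Lemma fracpart_itv x : 0 <= fracpart x < 1.
Proof. by rewrite /fracpart subr_ge0 floor_le ltrBlDl -[1]/(1%:~R) -intrD floorD1_gt. Qed.

Lemma fracpartD (x : R) (n : int) : fracpart (x + n%:~R) = fracpart x.
Proof.
by rewrite /fracpart floorDrz ?intr_int // intrD intrKfloor opprD addrACA subrr addr0.
Qed.

Lemma fracpart_id x : 0 <= x < 1 -> fracpart x = x.
Proof.
move=> /andP[x0 x1]; rewrite /fracpart (@floor_def _ x 0) ?subr0 //.
by rewrite x0 add0r.
Qed.

Definition per_bernoulli y : R := bernoulli.[fracpart y].

(* The periodization of spline u: telescoping the truncated powers leaves only
   the periodized Bernoulli polynomial (see sum_spline). *)
Definition per_spline u y : R := u ^+ r.+1 - iter r.+1 (cdiff u) per_bernoulli y.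

Lemma per_bernoulliD y (n : int) : per_bernoulli (y + n%:~R) = per_bernoulli y.
Proof. by rewrite /per_bernoulli fracpartD. Qed.

Lemma per_splineD u y (n : int) : per_spline u (y + n%:~R) = per_spline u y.
Proof.
rewrite /per_spline -iter_cdiff_shift.
by congr (_ - _); apply: eq_iter_cdiff => z; rewrite per_bernoulliD.
Qed.

Definition bernoulli_bound : R := \sum_(i < size bernoulli) `|bernoulli`_i|.

Lemma per_bernoulli_le y : `|per_bernoulli y| <= bernoulli_bound.
Proof.
rewrite /per_bernoulli horner_coef; apply: le_trans (ler_norm_sum _ _ _) _.
apply: ler_sum => i _; rewrite normrM ler_piMr // normrX.
have /andP[f0 f1] := fracpart_itv y.
by rewrite exprn_ile1 ?ger0_norm // ltW.
Qed.

Definition spline_const : R := 2 ^+ r.+1 * bernoulli_bound.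

Lemma spline_const_ge0 : 0 <= spline_const.
Proof. by rewrite mulr_ge0 ?exprn_ge0 // sumr_ge0. Qed.

Lemma per_spline_near u y : `|per_spline u y - u ^+ r.+1| <= spline_const.
Proof.
rewrite /per_spline addrAC subrr add0r normrN.
exact: iter_cdiff_bound per_bernoulli_le _.
Qed.

Lemma sum_tpow y (K : nat) : `|y| < K%:R ->
  \sum_(i < 2 * K) tpow r (y + (i%:R - K%:R)) = bernoulli.[y + K%:R] - per_bernoulli y.
Proof.
(* F is a primitive of the truncated power for the unit difference: its two branches agree on [0,
   1), and the left one has period 1. *)
move=> hy; pose F z := if 0 <= z then bernoulli.[z] else per_bernoulli z.
have step z : tpow r z = F (z + 1) - F z.
  rewrite /F /tpow; case: (leP 0 z) => z0.
    by rewrite addr_ge0 // bernoulliD1.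
  have e : per_bernoulli (z + 1) = per_bernoulli z by rewrite -(per_bernoulliD z 1).
  case: (leP 0 (z + 1)) => z1; last by rewrite e subrr.
  by rewrite -e /per_bernoulli fracpart_id ?subrr // z1; lra.
have tele n : \sum_(i < n) tpow r (y + (i%:R - K%:R)) = F (y - K%:R + n%:R) - F (y - K%:R).
  elim: n => [|n IH]; first by rewrite big_ord0 addr0 subrr.
  rewrite big_ord_recr /= IH step -[n.+1]addn1 natrD.
  have -> : y + (n%:R - K%:R) = y - K%:R + n%:R by ring.
  by rewrite [_ + (n%:R + 1)]addrA; ring.
move: hy; rewrite ltr_norml => /andP[h1 h2].
rewrite tele /F natrM.
have -> : y - K%:R + 2 * K%:R = y + K%:R by ring.
rewrite ifT; last by lra.
rewrite ifF; last by apply/negbTE; rewrite -ltNge; lra.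
by rewrite -(per_bernoulliD y (- K%:Z)) intrN.
Qed.

Lemma sum_spline u y (K : nat) : 0 < u -> `|y| + r.+1%:R * u / 2 < K%:R ->
  \sum_(i < 2 * K) spline u (y + (i%:R - K%:R)) = per_spline u y.
Proof.
move=> u0 hK; rewrite /spline.
under eq_bigr do rewrite -iter_cdiff_shift.
rewrite -(@iter_cdiff_sum R r.+1 u _ (fun i z => tpow r (z + (i%:R - K%:R)))).
rewrite (@iter_cdiff_eq _ _ _ _ (fun z => bernoulli.[z + K%:R] - per_bernoulli z)) // => [|z hz].
  by rewrite iter_cdiffB (iter_cdiff_shift _ _ (horner bernoulli)) iter_cdiff_bernoulli.
apply: sum_tpow; rewrite -(subrK y z); apply: le_lt_trans (ler_normD _ _) _.
by lra.
Qed.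

Lemma tpow_scale c x : 0 < c -> tpow r (c * x) = c ^+ r * tpow r x.
Proof.
move=> c0; rewrite /tpow pmulr_rge0 //; case: ifP => _; last by rewrite mulr0.
by rewrite exprMn mulrA.
Qed.

Lemma spline_scale c u x : 0 < c -> spline (c * u) (c * x) = c ^+ r * spline u x.
Proof.
move=> c0; rewrite /spline -iter_cdiff_scale -iter_cdiffZ.
by apply: eq_iter_cdiff => y; exact: tpow_scale.
Qed.

(** The shifts by j / N together with the integers form the grid of step 1/N; dilating by N turns
    the sum over it into a periodization of the dilated spline. *)
Lemma sum_per_spline (N : nat) u x : (0 < N)%N -> 0 < u ->
  \sum_(j < N) per_spline u (x + j%:R / N%:R) = N%:R ^- r * per_spline (N%:R * u) (N%:R * x).
Proof.
move=> N0 u0; have NR : 0 < N%:R :> R by rewrite ltr0n.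
have [K hK] : exists K : nat, `|x| + 1 + r.+1%:R * u / 2 < K%:R.
  exists (Num.truncn (`|x| + 1 + r.+1%:R * u / 2)).+1; exact: truncnS_gt.
under eq_bigr => j _.
  rewrite -(@sum_spline _ _ K) //; last first.
    apply: le_lt_trans hK; rewrite lerD2r; apply: le_trans (ler_normD _ _) _.
    rewrite lerD2l ger0_norm ?divr_ge0 // ler_pdivrMr // mul1r ler_nat ltnW //.
  over.
rewrite -(@sum_spline _ _ (K * N)) ?mulr_gt0 //; last first.
  have -> : `|N%:R * x| + r.+1%:R * (N%:R * u) / 2 = N%:R * (`|x| + r.+1%:R * u / 2).
    by rewrite normrM gtr0_norm //; ring.
  by rewrite natrM [K%:R * _]mulrC ltr_pM2l //; apply: le_lt_trans hK; lra.
rewrite mulr_sumr mulnA (sum_ord_mul _ _ (fun i => N%:R ^- r *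
  spline (N%:R * u) (N%:R * x + (i%:R - (K * N)%:R)))).
apply: eq_bigr => j _; apply: eq_bigr => i _.
have -> : N%:R * x + ((i * N + j)%:R - (K * N)%:R) =
    N%:R * (x + j%:R / N%:R + (i%:R - K%:R)).
  by rewrite natrD !natrM; field; rewrite gt_eqF.
by rewrite spline_scale // mulKf // expf_neq0 // gt_eqF.
Qed.

(** By dilation the error is N^-(r+1) times the deviation of a periodic spline of scale N u from its
    constant term, and [per_spline_near] bounds that deviation uniformly in the scale. *)
Lemma mean_per_spline (N : nat) u x : (0 < N)%N -> 0 < u ->
  `|N%:R^-1 * \sum_(j < N) per_spline u (x + j%:R / N%:R) - u ^+ r.+1|
   <= spline_const / N%:R ^+ r.+1.
Proof.
move=> N0 u0; have NR : 0 < N%:R :> R by rewrite ltr0n.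
rewrite sum_per_spline // mulrA -invfM -exprS.
have -> : (N%:R ^+ r.+1)^-1 * per_spline (N%:R * u) (N%:R * x) - u ^+ r.+1 =
   (per_spline (N%:R * u) (N%:R * x) - (N%:R * u) ^+ r.+1) / N%:R ^+ r.+1.
  by rewrite exprMn mulrBl [_ * u ^+ _]mulrC mulfK 1?mulrC // expf_neq0 // gt_eqF.
rewrite normrM normfV [`|N%:R ^+ _|]gtr0_norm ?exprn_gt0 //.
by rewrite ler_wpM2r ?per_spline_near // invr_ge0 exprn_ge0.
Qed.

End PeriodicSpline.

Local Open Scope classical_set_scope.
Local Open Scope ring_scope.

(** * Iterated convolutions are splines *)

Section SplineConvolution.
Variable R : realType.
Notation mu := (@lebesgue_measure R).

Lemma integral_deriv_poly (p : {poly R}) (a b : R) : a <= b ->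
  (\int[mu]_(x in `[a, b]) (p^`().[x])%:E = (p.[b] - p.[a])%:E)%E.
Proof.
rewrite le_eqVlt => /predU1P[->|ab].
  by rewrite set_itv1 integral_set1 subrr.
rewrite (@continuous_FTC2 _ (horner p^`()) (horner p)) //.
- apply: continuous_subspaceT => x; exact: continuous_horner.
- split.
  + by move=> x _; exact: derivable_horner.
  + by apply: cvg_at_right_filter; exact: continuous_horner.
  + by apply: cvg_at_left_filter; exact: continuous_horner.
- by move=> x _; rewrite derivE.
Qed.

Lemma integrable_poly (p : {poly R}) (a b : R) :
  mu.-integrable `[a, b] (EFin \o horner p).
Proof.
apply: continuous_compact_integrable; first exact: segment_compact.
by apply: continuous_subspaceT => x; exact: continuous_horner.
Qed.

Definition window (u : R) : R -> R := \1_(`[- (u / 2), u / 2[).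

(** The condition under which convolution with the window commutes with differences. *)
Definition conv_integrable (u : R) (f : R -> R) := forall x,
  mu.-integrable setT (EFin \o (fun y => f (x - y) * window u y)).

Lemma conv_integrable_cdiff u v f : conv_integrable u f ->
  conv_integrable u (cdiff v f) /\
  forall x, convolution (cdiff v f) (window u) x = cdiff v (convolution f (window u)) x.
Proof.
move=> fi.
have E x : (fun y => cdiff v f (x - y) * window u y) =
    (fun y => f (x + v / 2 - y) * window u y - f (x - v / 2 - y) * window u y).
  apply/funext => y; rewrite /cdiff mulrBl.
  by rewrite [x - y + _]addrAC [x - y - _]addrAC.
split => x.
  rewrite E; have := integrableB measurableT (fi (x + v / 2)) (fi (x - v / 2)).
  by apply: eq_integrable.
by rewrite /convolution E RintegralB.
Qed.

Lemma iter_conv_cdiff k u v f : conv_integrable u f ->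
  forall x, convolution (iter k (cdiff v) f) (window u) x =
    iter k (cdiff v) (convolution f (window u)) x.
Proof.
move=> fi x.
suff [] : conv_integrable u (iter k (cdiff v) f) /\
  convolution (iter k (cdiff v) f) (window u) =1 iter k (cdiff v) (convolution f (window u)) by [].
elim: k {x} => [//|k [IH1 IH2]].
have [h1 h2] := conv_integrable_cdiff v IH1.
by split => // x; rewrite iterS h2 /= /cdiff !IH2.
Qed.

Lemma conv_tpow (r : nat) (u : R) : 0 < u ->
  conv_integrable u (@tpow R r) /\
  forall x, convolution (@tpow R r) (window u) x = cdiff u (@tpow R r.+1) x.
Proof.
move=> u0.
pose F x : {poly R} := - (r.+1`!%:R^-1 *: (x%:P - 'X) ^+ r.+1).
have FE x y : (F x).[y] = - ((x - y) ^+ r.+1 / r.+1`!%:R).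
  by rewrite hornerN hornerZ horner_exp hornerD hornerN hornerX hornerC mulrC.
have dFE x y : (F x)^`().[y] = (x - y) ^+ r / r`!%:R.
  rewrite /F derivN derivZ deriv_exp derivB derivC derivX sub0r mulN1r.
  rewrite hornerN hornerZ hornerMn hornerN horner_exp hornerD hornerN hornerX hornerC. rewrite /=.
  rewrite mulNrn mulrN opprK -(mulr_natr (_ ^+ r)) factS natrM [RHS]mulrC.
  have f0 : r`!%:R != 0 :> R by rewrite pnatr_eq0 -lt0n fact_gt0.
  have r0 : r.+1%:R != 0 :> R by rewrite pnatr_eq0.
  move: (r`!%:R) (r.+1%:R) f0 r0 => a c a0 c0 /=; field; exact/andP.
(* The integrand is a polynomial, with primitive F x, cut off to S: the whole window if x >= u / 2,
   its part up to x otherwise. *)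
have key x : exists S : set (measurableTypeR R), [/\ measurable S, S `<=` `[- (u / 2), u / 2],
    (fun y => tpow r (x - y) * window u y) = (horner (F x)^`()) \_ S &
    (\int[mu]_(y in S) ((F x)^`().[y])%:E = (cdiff u (@tpow R r.+1) x)%:E)%E].
  have mF (A : set R) : measurable_fun A (horner (F x)^`()).
    exact: measurable_poly.
  case: (leP (u / 2) x) => xu.
    exists `[- (u / 2), u / 2[%classic; split => //.
    - by move=> y /=; rewrite !in_itv /= => /andP[-> /ltW].
    - apply/funext => y; rewrite /window indicE patchE; case: ifPn; rewrite ?mulr0 // mulr1.
      rewrite inE /= in_itv /= => /andP[_ yu]; rewrite dFE /tpow ifT //.
      by rewrite subr_ge0 ltW // (lt_le_trans yu).
    - rewrite integral_itv_bndo_bndc ?integral_deriv_poly; [|by lra|exact/measurable_EFinP].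
      rewrite !FE /cdiff /tpow !ifT; [|lra|lra].
      by congr (_%:E); rewrite !opprK addrC.
  exists `[- (u / 2), x]%classic; split => //.
  - by move=> y /=; rewrite !in_itv /= => /andP[-> yx] /=; rewrite (le_trans yx) // ltW.
  - apply/funext => y; rewrite /window indicE patchE; case: ifPn.
      rewrite inE /= in_itv /= => /andP[ay yx]; rewrite mem_set ?mulr1; last first.
        by rewrite /= in_itv /= ay (le_lt_trans yx).
      by rewrite dFE /tpow ifT // subr_ge0.
    rewrite notin_setE /= in_itv /= => h; rewrite /tpow.
    case: ifPn => [xy|_]; last by rewrite mul0r.
    rewrite memNset ?mulr0 //= in_itv /= => /andP[ay _]; apply: h.
    by rewrite ay -subr_ge0.
  - case: (leP (- (u / 2)) x) => ux; last first.
      rewrite set_itv_ge ?integral_set0; last by rewrite bnd_simp -ltNge.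
      by rewrite /cdiff /tpow !ifF ?subrr //; apply/negbTE; rewrite -ltNge; lra.
    rewrite integral_deriv_poly // !FE subrr expr0n mul0r oppr0 sub0r opprK /cdiff /tpow.
    rewrite ifT; last by lra.
    rewrite ifF ?subr0; last by apply/negbTE; rewrite -ltNge; lra.
    by rewrite opprK.
split => x; have [S [mS Sab hE hI]] := key x.
  have mI : measurable (`[- (u / 2), u / 2]%classic : set (measurableTypeR R)).
    exact: measurable_itv.
  rewrite hE; have := integrableS mI mS Sab (integrable_poly (F x)^`() _ _).
  move/(integrable_mkcond _ mS); apply: eq_integrable => // y _.
  by rewrite /= restrict_EFin.
rewrite /convolution hE -Rintegral_mkcond /Rintegral.
by rewrite hI.
Qed.

(** Convolution with the window commutes with differences and maps a truncated power to the
    difference of the next one. *)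
Lemma hfunE (r : nat) (u : R) : 0 < u -> hfun r.+1 u =1 spline r u.
Proof.
move=> u0; rewrite /hfun /=; elim: r => [|r IH] x.
  rewrite /= /spline /= /cdiff /tpow !expr0 fact0 invr1 mulr1 indicE.
  have -> : (x \in `[- (u / 2), u / 2[%classic) = (0 <= x + u / 2) && ~~ (0 <= x - u / 2).
    rewrite -ltNge; apply/idP/idP; rewrite inE /= in_itv /=.
      by move=> /andP[h1 h2]; apply/andP; split; lra.
    by move=> /andP[h1 h2]; apply/andP; split; lra.
  have : 0 <= x - u / 2 -> 0 <= x + u / 2 by lra.
  by case: (0 <= x - u / 2) => [/(_ isT) -> | _]; case: (0 <= x + u / 2); rewrite /= ?subrr ?subr0.
rewrite [LHS]/=.
have -> : iter r (fun f => convolution f (window u)) (window u) = spline r u by apply/funext.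
have [h1 h2] := conv_tpow r u0.
rewrite /spline (iter_conv_cdiff _ _ h1).
by rewrite (eq_iter_cdiff _ _ h2) -iterSr.
Qed.

(** The sign is invisible in the difference formula but plain from the convolutions. *)
Lemma spline_ge0 (r : nat) (u x : R) : 0 < u -> 0 <= spline r u x.
Proof.
move=> u0; rewrite -hfunE // /hfun /=; elim: r x => [|r IH] x; first by rewrite /= indicE.
apply: Rintegral_ge0 => y _; apply: mulr_ge0; [exact: IH | by rewrite indicE].
Qed.

Lemma per_spline_ge0 r u x : 0 < u -> 0 <= per_spline r u x :> R.
Proof.
move=> u0; rewrite -(@sum_spline R r u x (Num.truncn (`|x| + r.+1%:R * u / 2)).+1) //.
  by apply: sumr_ge0 => i _; exact: spline_ge0.
exact: truncnS_gt.
Qed.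

(** Differences of steps 1/N and u commute, so the differences of step 1/N of the spline of scale u
    are those of step u of the spline of scale 1/N. The latter is nonnegative and its N samples sum
    to N^-r times a bounded value, whence a bound uniform in u. *)
Lemma l1_diff_per_spline (r N : nat) (u x : R) : (0 < N)%N -> 0 < u ->
  N%:R^-1 * \sum_(j < N) `|iter r.+1 (cdiff N%:R^-1) (per_spline r u) (x + j%:R / N%:R)|
   <= 2 ^+ r.+1 * (1 + spline_const R r) / N%:R ^+ r.+1.
Proof.
move=> N0 u0; have NR : 0 < N%:R :> R by rewrite ltr0n.
have E y : iter r.+1 (cdiff N%:R^-1) (per_spline r u) y =
    iter r.+1 (cdiff u) (per_spline r N%:R^-1) y.
  have F a c : iter r.+1 (cdiff a) (per_spline r c) y =
      - iter r.+1 (cdiff a) (iter r.+1 (cdiff c) (per_bernoulli r)) y.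
    by rewrite (iter_cdiffB _ _ (fun=> c ^+ r.+1)) iter_cdiff_cst sub0r.
  by rewrite !F iter_cdiffC.
under eq_bigr do rewrite E.
have Ni : 0 < N%:R^-1 :> R by rewrite invr_gt0.
have h z : \sum_(j < N) `|per_spline r N%:R^-1 (z + j%:R * N%:R^-1)| <=
    N%:R ^- r * (1 + spline_const R r).
  under eq_bigr do rewrite ger0_norm ?per_spline_ge0 //.
  rewrite sum_per_spline // ler_wpM2l ?invr_ge0 ?exprn_ge0 //.
  rewrite divff ?gt_eqF //; have := per_spline_near r 1 (N%:R * z).
  by rewrite expr1n ler_norml => /andP[_]; lra.
apply: le_trans (ler_wpM2l (ltW Ni) (iter_cdiff_sum_bound r.+1 u h x)) _.
by rewrite le_eqVlt (exprS N%:R) invfM; apply/orP; left; apply/eqP; ring.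
Qed.

End SplineConvolution.

(** * Integrals of periodic functions *)

Section PeriodIntegral.
Variable R : realType.
Notation mu := (@lebesgue_measure R).
Local Open Scope ereal_scope.

Lemma lebesgue_measure_shift (c : R) (A : set R) : measurable A ->
  pushforward mu ((fun x => x + c)%R : _ -> measurableTypeR R) A = mu A.
Proof.
move=> mA.
have mshift : measurable_fun setT ((fun x => x + c)%R : measurableTypeR R -> measurableTypeR R).
  exact: measurable_funD.
pose f : {mfun _ >-> _} :=
  HB.pack ((fun x => x + c)%R : measurableTypeR R -> measurableTypeR R)
    (isMeasurableFun.Build _ _ _ _ _ mshift).
apply/esym.
apply: (@lebesgue_measure_unique _ (pushforward mu f)) => //= _ [[a b]] _ <-.
rewrite /pushforward /=.
have -> : (fun x => x + c)%R @^-1` `]a, b]%classic = `](a - c)%R, (b - c)%R]%classic.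
  by apply/seteqP; split => x /=; rewrite !in_itv /= ltrBlDr lerBrDr.
rewrite !lebesgue_measure_itv /= !lte_fin ltrD2r.
by case: ifP => // _; rewrite -!EFinD; congr (_%:E); ring.
Qed.

Lemma ge0_integral_shift (f : R -> \bar R) (a b c : R) :
  measurable_fun setT f -> (forall x, 0 <= f x) ->
  \int[mu]_(x in `[(a + c)%R, (b + c)%R[) f x = \int[mu]_(x in `[a, b[) f (x + c)%R.
Proof.
move=> mf f0.
have mshift : measurable_fun setT ((fun x => x + c)%R : measurableTypeR R -> measurableTypeR R).
  exact: measurable_funD.
have -> : `[a, b[%classic =
    ((fun x => x + c)%R : measurableTypeR R -> measurableTypeR R)
      @^-1` `[(a + c)%R, (b + c)%R[%classic.
  by apply/seteqP; split => x /=; rewrite !in_itv /= lerD2r ltrD2r.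
rewrite -(ge0_integral_pushforward mshift) //; last exact: measurable_funS mf.
by apply: eq_measure_integral => A mA _; exact/esym/lebesgue_measure_shift.
Qed.

Lemma ge0_integral_periods (f : R -> \bar R) (d : R) (n : nat) : (0 < d)%R ->
  measurable_fun setT f -> (forall x, 0 <= f x) ->
  \int[mu]_(x in `[0%R, (n%:R * d)%R[) f x =
  \int[mu]_(x in `[0%R, d[) \sum_(i < n) f (x + i%:R * d)%R.
Proof.
move=> d0 mf f0.
have mfs (c : R) : measurable_fun [set: R] (fun x : R => f (x + c)%R).
  have ms : measurable_fun [set: R] (fun x : R => (x + c)%R) by exact: measurable_funD.
  exact: measurableT_comp mf ms.
elim: n => [|n IH].
  rewrite mul0r set_itv_ge ?integral_set0 ?bnd_simp ?ltxx //.
  by under eq_integral do rewrite big_ord0; rewrite integral0.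
have nd : (0 <= n%:R * d)%R by rewrite mulr_ge0 // ltW.
have e : (n.+1%:R * d = n%:R * d + d)%R by rewrite -addn1 natrD mulrDl mul1r.
have -> : `[0%R, (n.+1%:R * d)%R[%classic =
    `[0%R, (n%:R * d)%R[%classic `|` `[(n%:R * d)%R, (n%:R * d + d)%R[%classic.
  apply/seteqP; split => x /=; rewrite !in_itv /= e.
    move=> /andP[h1 h2]; case: (ltP x (n%:R * d)%R) => h; [left|right]; exact/andP.
  by move=> [/andP[h1 h2]|/andP[h1 h2]]; apply/andP; split; lra.
rewrite ge0_integral_setU //; last 2 first.
- exact: measurable_funS mf.
- apply/disj_setPS => x /= []; rewrite !in_itv /= => /andP[_ h1] /andP[h2 _].
  by move: h1; rewrite ltNge h2.
have S := ge0_integral_shift 0 d (n%:R * d) mf f0.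
rewrite add0r [(d + _)%R]addrC in S; rewrite IH S.
rewrite -ge0_integralD.
- by apply: eq_integral => x _; rewrite big_ord_recr.
- exact: measurable_itv.
- by move=> x _; apply: sume_ge0.
- by apply: emeasurable_sum => i; apply: measurable_funTS; exact: mfs.
- by move=> x _.
- by apply: measurable_funTS; exact: mfs.
Qed.

End PeriodIntegral.

Section Periodization.
Variable R : realType.

Lemma periodized_hboxE (r : nat) (a u x : R * R) : 0 < u.1 -> 0 < u.2 ->
  periodized_hbox r.+1 a u x =
  per_spline r u.1 (x.1 - a.1) * per_spline r u.2 (x.2 - a.2).
Proof.
move=> u1 u2.
pose bd (y v : R) := `|y| + r.+1%:R * v / 2.
(* Large enough for all translates by integers outside [-K, K) to vanish at x, in either
   coordinate. *)
pose K := (Num.truncn (bd (x.1 - a.1) u.1 + bd (x.2 - a.2) u.2)).+1.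
have bd0 y v : 0 < v -> 0 <= bd y v.
  by move=> v0; rewrite addr_ge0 // !mulr_ge0 // ltW.
have hK : bd (x.1 - a.1) u.1 + bd (x.2 - a.2) u.2 < K%:R by exact: truncnS_gt.
have K1 : bd (x.1 - a.1) u.1 < K%:R by apply: le_lt_trans hK; rewrite lerDl bd0.
have K2 : bd (x.2 - a.2) u.2 < K%:R by apply: le_lt_trans hK; rewrite lerDr bd0.
pose rg := [seq (i%:Z - K%:Z) | i <- iota 0 (2 * K)].
have rgP (m : int) : (m \in rg) = (- K%:Z <= m < K%:Z).
  apply/mapP/idP => [[k]|/andP[h1 h2]].
    by rewrite mem_iota => /andP[_ hi] ->; lia.
  exists `|(m + K%:Z)%R|%N; last by lia.
  by rewrite mem_iota; lia.
have urg : uniq rg.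
  by rewrite map_inj_uniq ?iota_uniq // => i j; lia.
have out (m : int) y v : 0 < v -> bd y v < K%:R -> m \notin rg ->
    spline r v (m%:~R + y) = 0.
  move=> v0 hb; rewrite rgP => hm; apply: spline_support => //.
  have : K%:R <= `|m%:~R : R|.
    rewrite -intr_norm -[K%:R]/(K%:Z%:~R) ler_int; lia.
  have := ler_normD (m%:~R + y) (- y); rewrite addrK normrN.
  by move: hb; rewrite /bd; lra.
pose s := [seq (i, j) | i <- rg, j <- rg].
have us : uniq s by apply: allpairs_uniq => // -[? ?] [? ?] _ _ /= [-> ->].
have sumE y v : 0 < v -> bd y v < K%:R ->
    \sum_(i <- rg) spline r v (i%:~R + y) = per_spline r v y.
  move=> v0 hb; rewrite big_map -(sum_spline v0 hb) -(big_mkord xpredT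
    (fun i => spline r v (y + (i%:R - K%:R)))) /index_iota subn0.
  by apply: eq_bigr => i _; rewrite addrC intrB.
have gE m : hbox r.+1 a u (m.1%:~R + x.1, m.2%:~R + x.2) =
    spline r u.1 (m.1%:~R + (x.1 - a.1)) * spline r u.2 (m.2%:~R + (x.2 - a.2)).
  by rewrite /hbox /= !hfunE // !addrA.
have g0 (m : int * int) : (0 <= (hbox r.+1 a u (m.1%:~R + x.1, m.2%:~R + x.2))%:E)%E.
  by rewrite lee_fin gE mulr_ge0 // spline_ge0.
rewrite /periodized_hbox.
have -> : (\esum_(m in [set: int * int])
    (hbox r.+1 a u (m.1%:~R + x.1, m.2%:~R + x.2))%:E =
   \esum_(m in [set` s]) (hbox r.+1 a u (m.1%:~R + x.1, m.2%:~R + x.2))%:E)%E.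
  rewrite [RHS]esum_mkcond; apply: eq_esum => m _.
  case: ifPn => //; rewrite notin_setE /= => hm; congr (_%:E); rewrite gE.
  have : ~~ ((m.1 \in rg) && (m.2 \in rg)).
    apply/negP => /andP[h1 h2]; apply: hm; apply/allpairsP; exists m.
    by split => //; case: (m).
  by rewrite negb_and => /orP[] /out h; rewrite h ?mul0r ?mulr0.
rewrite esum_fset //; last by exact: finite_seq.
rewrite -fsbig_seq // sumEFin /= big_allpairs.
under eq_bigr => i _ do under eq_bigr => j _ do rewrite gE /=.
under eq_bigr do rewrite -mulr_sumr sumE //.
by rewrite -mulr_suml sumE.
Qed.

End Periodization.

Section PeriodizedMean.
Variable R : realType.
Notation mu := (@lebesgue_measure R).

Lemma measurable_fracpart : measurable_fun [set: R] (@fracpart R).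
Proof.
apply: measurable_funB => //.
by apply: nondecreasing_measurable => // x y xy; rewrite ler_int le_floor.
Qed.

Lemma measurable_cdiff u (f : R -> R) :
  measurable_fun [set: R] f -> measurable_fun [set: R] (cdiff u f).
Proof.
move=> mf; apply: measurable_funB; apply: (measurableT_comp mf).
  exact: measurable_funD.
exact: measurable_funB.
Qed.

Lemma measurable_per_spline r u : measurable_fun [set: R] (@per_spline R r u).
Proof.
apply: measurable_funB => //.
elim: r.+1 => [|k IH]; last exact: measurable_cdiff.
rewrite /= /per_bernoulli; apply: (measurableT_comp (f := horner (bernoulli R r))).
  exact: measurable_poly.
exact: measurable_fracpart.
Qed.

Lemma measurable_per_splineB r u c :
  measurable_fun [set: R] (fun x => @per_spline R r u (x - c)).
Proof.
by apply: (measurableT_comp (measurable_per_spline r u)); exact: measurable_funB.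
Qed.

(* The mean over one period is u^(r+1) up to O(N^(-r-1)) for every N, since
   the mean over N equidistant points is. *)
Lemma integral_per_spline r (u c : R) : 0 < u ->
  (\int[mu]_(x in `[0%R, 1%R[) (per_spline r u (x - c))%:E = (u ^+ r.+1)%:E)%E.
Proof.
move=> u0; set J := (X in X = _).
have ps0 x : 0 <= per_spline r u x by exact: per_spline_ge0.
have mps : measurable_fun [set: R] (EFin \o (fun x => per_spline r u (x - c))).
  by apply/measurable_EFinP; exact: measurable_per_splineB.
have C0 := spline_const_ge0 R r.
have bnd (N : nat) : (0 < N)%N ->
   ((u ^+ r.+1 - spline_const R r / N%:R ^+ r.+1)%:E <= J /\
    J <= (u ^+ r.+1 + spline_const R r / N%:R ^+ r.+1)%:E)%E.
  move=> N0; have NR : 0 < N%:R :> R by rewrite ltr0n.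
  have Ni : 0 < N%:R^-1 :> R by rewrite invr_gt0.
  set e := _ / _.
  pose S (x : R) := \sum_(i < N) per_spline r u (x + i%:R / N%:R - c).
  have SE x : `|N%:R^-1 * S x - u ^+ r.+1| <= e.
    have -> : S x = \sum_(i < N) per_spline r u ((x - c) + i%:R / N%:R).
      by apply: eq_bigr => i _; rewrite addrAC.
    by apply: mean_per_spline => // v y; exact: spline_ge0.
  have S0 x : 0 <= S x by apply: sumr_ge0.
  have JE : J = (\int[mu]_(x in `[0%R, N%:R^-1%R[) (S x)%:E)%E.
    rewrite /J; have := ge0_integral_periods N Ni mps (fun x => ps0 (x - c)).
    rewrite divff ?gt_eqF // => ->.
    by apply: eq_integral => x _; rewrite /S -sumEFin.
  have mS (D : set R) : measurable_fun D S.
    apply: measurable_sum => i; apply: measurable_funTS.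
    have -> : (fun x => per_spline r u (x + i%:R / N%:R - c)) =
      (fun x => per_spline r u (x - (c - i%:R / N%:R))).
      by apply/funext => x; congr per_spline; ring.
    exact: measurable_per_splineB.
  have icst (k : R) : (\int[mu]_(x in `[0%R, N%:R^-1%R[) k%:E = (k / N%:R)%:E)%E.
    have mi : mu `[0%R, N%:R^-1%R[%classic = (N%:R^-1)%:E.
      by rewrite lebesgue_measure_itv /= lte_fin Ni -EFinD subr0.
    by rewrite integral_cst //= mi -EFinM.
  split.
    (* The positive part keeps the minorant nonnegative, as the comparison of integrals demands. *)
    apply: (@le_trans _ _ (Num.max 0 (u ^+ r.+1 - e))%:E).
      by rewrite lee_fin le_max lexx orbT.
    rewrite JE; have := icst (N%:R * Num.max 0 (u ^+ r.+1 - e)).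
    rewrite mulrAC divff ?gt_eqF // mul1r => <-.
    apply: ge0_le_integral => //.
    - by move=> x _; rewrite lee_fin mulr_ge0 // le_max lexx.
    - by apply/measurable_EFinP; exact: mS.
    - move=> x _; rewrite lee_fin -ler_pdivlMl // ge_max mulr_ge0 ?(ltW Ni) //=.
      by have := SE x; rewrite ler_norml => /andP[h _]; lra.
  rewrite JE; have := icst (N%:R * (u ^+ r.+1 + e)).
  rewrite mulrAC divff ?gt_eqF // mul1r => <-.
  apply: ge0_le_integral => //.
  - by move=> x _; rewrite lee_fin.
  - by apply/measurable_EFinP; exact: mS.
  - move=> x _; rewrite lee_fin -ler_pdivrMl //.
    by have := SE x; rewrite ler_norml => /andP[_ h]; lra.
have Jfin : J \is a fin_num.
  have [h1 h2] := bnd 1%N isT.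
  by rewrite fin_numElt (lt_le_trans _ h1) ?ltNyr // (le_lt_trans h2) ?ltry.
rewrite -(fineK Jfin) in bnd *; congr (_%:E).
apply/eqP; rewrite -subr_eq0 -normr_eq0; apply/negPn/negP => h.
have d0 : 0 < `|fine J - u ^+ r.+1| by rewrite lt_def h normr_ge0.
set d := `|_| in d0.
pose N := (Num.truncn (spline_const R r / d)).+1.
have hN : spline_const R r / d < N%:R by exact: truncnS_gt.
have [] := bnd N isT; rewrite !lee_fin => h1 h2.
have : d <= spline_const R r / N%:R ^+ r.+1 by rewrite ler_norml; lra.
rewrite leNgt => /negP; apply.
have N1 : 1 <= N%:R :> R by rewrite ler1n.
rewrite ltr_pdivrMr ?exprn_gt0 ?(lt_le_trans ltr01) //.
rewrite ltr_pdivrMr // mulrC in hN; apply: lt_le_trans hN _.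
by rewrite ler_pM2l // exprS ler_peMr ?exprn_ege1 // (le_trans ler01).
Qed.

Lemma integral_periodized_hbox (r : nat) (a u z : R * R) : 0 < u.1 -> 0 < u.2 ->
  \int[@lebesgue2 R]_(x in Omega2) periodized_hbox r.+1 a u (x.1 - z.1, x.2 - z.2) =
  u.1 ^+ r.+1 * u.2 ^+ r.+1.
Proof.
move=> u1 u2; rewrite /Rintegral.
have ps0 v y : 0 < v -> 0 <= per_spline r v y :> R.
  by move=> v0; exact: per_spline_ge0.
pose F1 x := per_spline r u.1 (x - (z.1 + a.1)) * \1_(`[0, 1[ : set R) x.
pose F2 x := per_spline r u.2 (x - (z.2 + a.2)) * \1_(`[0, 1[ : set R) x.
have F10 x : 0 <= F1 x by rewrite mulr_ge0 ?ps0 // indicE.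
have F20 x : 0 <= F2 x by rewrite mulr_ge0 ?ps0 // indicE.
have mF1 : measurable_fun [set: R] F1.
  by apply: measurable_funM; [exact: measurable_per_splineB | exact: measurable_indic].
have mF2 : measurable_fun [set: R] F2.
  by apply: measurable_funM; [exact: measurable_per_splineB | exact: measurable_indic].
have I1 : (\int[mu]_x (F1 x)%:E = (u.1 ^+ r.+1)%:E)%E.
  rewrite -(integral_per_spline r (z.1 + a.1) u1) [RHS]integral_mkcond.
  apply: eq_integral => x _; rewrite /F1 patchE indicE; case: ifP; rewrite ?mulr1 ?mulr0 //.
have I2 : (\int[mu]_x (F2 x)%:E = (u.2 ^+ r.+1)%:E)%E.
  rewrite -(integral_per_spline r (z.2 + a.2) u2) [RHS]integral_mkcond.
  apply: eq_integral => x _; rewrite /F2 patchE indicE; case: ifP; rewrite ?mulr1 ?mulr0 //.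
have -> : (\int[@lebesgue2 R]_(x in Omega2)
     (periodized_hbox r.+1 a u (x.1 - z.1, x.2 - z.2))%:E =
   \int[@lebesgue2 R]_x (F1 x.1 * F2 x.2)%:E)%E.
  rewrite integral_mkcond; apply: eq_integral => -[x y] _.
  rewrite patchE /= /F1 /F2 !indicE periodized_hboxE //= !opprD !addrA.
  have -> : ((x, y) \in Omega2) = (x \in `[0, 1[%classic) && (y \in `[0, 1[%classic).
    by rewrite in_setX.
  by case: (x \in _); case: (y \in _); rewrite /= ?mulr1 ?mulr0 ?mul0r.
rewrite /lebesgue2 fubini_tonelli1 /=; last 2 first.
- apply/measurable_EFinP; apply: measurable_funM.
    exact: measurableT_comp mF1 measurable_fst.
  exact: measurableT_comp mF2 measurable_snd.
- by move=> x; rewrite lee_fin mulr_ge0.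
under eq_integral => x _.
  rewrite /fubini_F /=; under eq_integral do rewrite EFinM.
  rewrite ge0_integralZl_EFin //; last 2 first.
  + by move=> y _; rewrite lee_fin.
  + exact/measurable_EFinP.
  rewrite I2; over.
rewrite ge0_integralZr // ?I1 //.
- exact/measurable_EFinP.
- by move=> x _; rewrite lee_fin.
- by rewrite lee_fin exprn_ge0 // ltW.
Qed.

End PeriodizedMean.

(** * The smooth discrepancy *)

Section SampledSpline.
Variable R : realType.

(** One constant for three bounds: the first summand covers the samples and their differences, the
    second the gap between the product of the integrals and that of the sample means. *)
Definition sample_const (r : nat) : R :=
  2 ^+ r.+1 * (1 + spline_const R r) + spline_const R r * (2 + spline_const R r).

Lemma sample_const_gt0 r : 0 < sample_const r.
Proof.
have C0 := spline_const_ge0 R r.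
have h1 : 0 < 2 ^+ r.+1 * (1 + spline_const R r).
  by apply: mulr_gt0; [exact: exprn_gt0 | lra].
have h2 : 0 <= spline_const R r * (2 + spline_const R r) by apply: mulr_ge0 => //; lra.
by rewrite /sample_const ltr_pwDl.
Qed.

(** Each forward difference is a central one moved by d / 2. *)
Lemma iter_fdiff_sample (f : R -> R) (x d : R) k j :
  iter k (@fdiff R) (fun i : int => f (x + i%:~R * d)) j =
  iter k (cdiff d) f (x + k%:R * d / 2 + j%:~R * d).
Proof.
elim: k j => [|k IH] j; first by rewrite !mul0r addr0.
rewrite !iterS {1}/fdiff !IH {2}/cdiff intrD -[k.+1]addn1 natrD.
by congr (_ - _); congr (iter _ _ _ _); field.
Qed.

Lemma smooth_errorE (r n : nat) (a u : R * R) (t z2 : R) (m : nat) :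
  (0 < n)%N -> 0 < u.1 -> 0 < u.2 -> let N := fibn n in
  smooth_error r.+1 (@fibonacci_set R n) a u (t + m%:R / N%:R, z2) =
  u.1 ^+ r.+1 * u.2 ^+ r.+1 - N%:R^-1 * \sum_(k < N)
    per_spline r u.1 (- t - a.1 + (k%:Z - m%:Z)%:~R / N%:R) *
    per_spline r u.2 (- z2 - a.2 + ((fibn n.-1)%:Z * k%:Z)%:~R / N%:R).
Proof.
move=> n0 u1 u2 N; have N0 : (0 < N)%N := fibn_gt0 n.
have NR : N%:R != 0 :> R by rewrite pnatr_eq0 -lt0n.
rewrite /smooth_error integral_periodized_hbox //; congr (_ - _ * _).
pose F (k : int) : R := per_spline r u.1 (- t - a.1 + (k - m%:Z)%:~R / N%:R) *
    per_spline r u.2 (- z2 - a.2 + ((fibn n.-1)%:Z * k)%:~R / N%:R).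
have perF k : F (k + N%:Z) = F k.
  rewrite /F; congr (_ * _).
    rewrite -[RHS](per_splineD _ _ _ 1); congr per_spline.
    by rewrite !intrD intrN -[(N%:Z)%:~R]/(N%:R); field.
  rewrite -[RHS](per_splineD _ _ _ (fibn n.-1)); congr per_spline.
  by rewrite mulrDr intrD !intrM -[(N%:Z)%:~R]/(N%:R); field.
(* The shift by 1 accounts for i standing for mu = i + 1; periodicity then removes the fractional
   parts. *)
rewrite -[RHS](sum_periodic 1 perF); apply: eq_bigr => i _.
rewrite periodized_hboxE //= /F /fracpart; congr (_ * _).
  rewrite -[LHS](per_splineD _ _ _ (Num.floor (i.+1%:R / N%:R : R))); congr per_spline.
  rewrite intrD intrN intrD -[i.+1]addn1 natrD -[(i%:Z)%:~R]/(i%:R) -[(m%:Z)%:~R]/(m%:R).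
  by field.
rewrite -[LHS](per_splineD _ _ _ (Num.floor (i.+1%:R * (fibn n.-1)%:R / N%:R : R))).
congr per_spline.
rewrite intrM intrD -[i.+1]addn1 natrD -[(i%:Z)%:~R]/(i%:R).
by rewrite -[((fibn n.-1)%:Z)%:~R]/((fibn n.-1)%:R); field.
Qed.

Lemma sample_sums (r N : nat) (u x : R) : (0 < N)%N -> 0 < u -> 1 <= u * N%:R ->
  let H := fun j : int => per_spline r u (x + j%:~R / N%:R) in
  [/\ forall j, H (j + N%:Z) = H j,
      N%:R^-1 * \sum_(j < N) `|H j%:Z| <= sample_const r * u ^+ r.+1,
      N%:R^-1 * \sum_(j < N) `|iter r.+1 (@fdiff R) H j%:Z| <= sample_const r / N%:R ^+ r.+1 &
      `|N%:R^-1 * \sum_(j < N) H j%:Z - u ^+ r.+1| <= spline_const R r / N%:R ^+ r.+1].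
Proof.
move=> N0 u0 uN H; have NR : 0 < N%:R :> R by rewrite ltr0n.
have C0 := spline_const_ge0 R r.
have mean := mean_per_spline r x N0 u0.
have p2 : 1 <= 2 ^+ r.+1 :> R by rewrite exprn_ege1 // ler1n.
have NX : 0 < N%:R ^+ r.+1 :> R by rewrite exprn_gt0.
split.
- move=> j; rewrite /H -[RHS](per_splineD _ _ _ 1); congr per_spline.
  by rewrite intrD -[(N%:Z)%:~R]/(N%:R); field; rewrite gt_eqF.
- under eq_bigr do rewrite (ger0_norm (per_spline_ge0 _ _ u0)).
  have := mean; rewrite ler_norml => /andP[_ h].
  (* Here 1 <= u N is used: the quadrature error does not exceed the order of the mean. *)
  have : spline_const R r / N%:R ^+ r.+1 <= spline_const R r * u ^+ r.+1.
    rewrite ler_wpM2l // -[leLHS]mul1r ler_pdivrMr // -exprMn exprn_ege1 //.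
  have ur : 0 < u ^+ r.+1 by rewrite exprn_gt0.
  have : (1 + spline_const R r) * u ^+ r.+1 <= sample_const r * u ^+ r.+1.
    rewrite ler_wpM2r ?(ltW ur) // /sample_const.
    have h1 : 1 + spline_const R r <= 2 ^+ r.+1 * (1 + spline_const R r).
      by apply: ler_peMl => //; lra.
    have h2 : 0 <= spline_const R r * (2 + spline_const R r) by apply: mulr_ge0 => //; lra.
    by apply: le_trans h1 _; rewrite lerDl.
  move=> h1 h2; apply: le_trans h1; rewrite mulrDl mul1r.
  by apply: le_trans (lerD (lexx _) h2); lra.
- have := l1_diff_per_spline r (x + r.+1%:R * N%:R^-1 / 2) N0 u0.
  move=> h; under eq_bigr do rewrite /H iter_fdiff_sample.
  apply: le_trans h _; rewrite ler_wpM2r ?invr_ge0 ?(ltW NX) //.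
  by rewrite /sample_const lerDl; apply: mulr_ge0 => //; lra.
- exact: mean.
Qed.

Lemma smooth_error_mean_power (r n q : nat) (a u : R * R) (L t z2 : R) :
  (0 < n)%N -> 0 < u.1 <= 1 -> 0 < u.2 <= 1 -> let N := fibn n in
  1 <= u.1 * u.2 * N%:R -> 1 <= L -> ln (u.1 * u.2 * N%:R) <= L ->
  \sum_(m < N) smooth_error r.+1 (@fibonacci_set R n) a u (t + m%:R / N%:R, z2) ^+ (2 * q.+1)
   <= N%:R * (lattice_error_const q r (sample_const r) * Num.sqrt L / N%:R ^+ r.+1) ^+ (2 * q.+1).
Proof.
move=> n0 /andP[u1 u11] /andP[u2 u21] N uN L1 hL.
have N0 : (0 < N)%N := fibn_gt0 n.
have NR : 0 < N%:R :> R by rewrite ltr0n.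
under eq_bigr do rewrite smooth_errorE //.
have u1N : 1 <= u.1 * N%:R.
  by apply: le_trans uN _; rewrite ler_wpM2r // ler_piMr // ltW.
have u2N : 1 <= u.2 * N%:R.
  by apply: le_trans uN _; rewrite ler_wpM2r // ler_piMl // ltW.
have [p1 a1 d1 e1] := sample_sums r (- t - a.1) N0 u1 u1N.
have [p2 a2 d2 e2] := sample_sums r (- z2 - a.2) N0 u2 u2N.
apply: (lattice_error_mean_power q n0 (sample_const_gt0 r) u1 u2 p1 p2 a1 a2 d1 d2 uN L1 hL).
have C0 := spline_const_ge0 R r.
set m1 := N%:R^-1 * _ in e1 *; set m2 := N%:R^-1 * _ in e2 *.
have NX : 1 <= N%:R ^+ r.+1 :> R by rewrite exprn_ege1 // ler1n.
have NX0 : 0 < N%:R ^+ r.+1 :> R := lt_le_trans ltr01 NX.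
set e := spline_const R r / _ in e1 e2.
have e0 : 0 <= e by rewrite divr_ge0 // ltW.
have eC : e <= spline_const R r by rewrite ler_pdivrMr // ler_peMr.
have U1 : `|u.1 ^+ r.+1| <= 1 by rewrite ger0_norm ?exprn_ile1 ?exprn_ge0 ?(ltW u1).
have m2B : `|m2| <= 1 + spline_const R r.
  have -> : m2 = (m2 - u.2 ^+ r.+1) + u.2 ^+ r.+1 by rewrite subrK.
  apply: le_trans (ler_normD _ _) _; rewrite addrC lerD ?(le_trans e2) //.
  by rewrite ger0_norm ?exprn_ile1 ?exprn_ge0 ?(ltW u2).
have -> : u.1 ^+ r.+1 * u.2 ^+ r.+1 - m1 * m2 =
  - (u.1 ^+ r.+1 * (m2 - u.2 ^+ r.+1) + (m1 - u.1 ^+ r.+1) * m2) by ring.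
rewrite normrN; apply: le_trans (ler_normD _ _) _; rewrite [`|_ ^+ _ * _|]normrM [`|_ * m2|]normrM.
apply: (@le_trans _ _ (1 * e + e * (1 + spline_const R r))).
  apply: lerD; first exact: (ler_pM (normr_ge0 _) (normr_ge0 _) U1 e2).
  exact: (ler_pM (normr_ge0 _) (normr_ge0 _) e1 m2B).
have -> : 1 * e + e * (1 + spline_const R r) =
  spline_const R r * (2 + spline_const R r) / N%:R ^+ r.+1 by rewrite /e; ring.
rewrite ler_wpM2r ?invr_ge0 ?(ltW NX0) // /sample_const lerDr.
by apply: mulr_ge0; [exact: exprn_ge0 | lra].
Qed.

End SampledSpline.

(** * From even moments along progressions to the L_p norm *)

Section LpNorm.
Variable R : realType.
Notation mu := (@lebesgue_measure R).

(** After scaling by M this is s^p <= 1 + s^K. It passes from an even K to a real p at the cost of a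
    factor 2 in the integral. *)
Lemma powR_le_even_power (p M e : R) (K : nat) : 0 <= p -> p <= K%:R -> ~~ odd K -> 0 < M ->
  `|e| `^ p <= M `^ p * (1 + (e / M) ^+ K).
Proof.
move=> p0 pK eK M0; have M00 := ltW M0.
have -> : `|e| = M * `|e / M|.
  by rewrite normrM normfV (gtr0_norm M0) mulrCA divff ?gt_eqF // mulr1.
rewrite powRM // ler_wpM2l ?powR_ge0 //.
have -> : (e / M) ^+ K = `|e / M| ^+ K by rewrite -normrX ger0_norm ?exprn_even_ge0.
set s := `|_|; have s0 : 0 <= s by exact: normr_ge0.
have [s1|s1] := leP s 1.
  rewrite -[leLHS]addr0 lerD ?exprn_ge0 //.
  apply: (@le_trans _ _ (1 `^ p)); last by rewrite powR1.
  by rewrite ge0_ler_powR ?nnegrE.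
apply: (@le_trans _ _ (s ^+ K)); last by rewrite lerDr.
by rewrite -powR_mulrn // ler_powR // ltW.
Qed.

(** For fixed y the integral over [0, 1) is that over [0, 1/N) of the sum of the N translates. The
    p-th power integral is then at most 2 M^p, and 2^(1/p) <= 2. *)
Lemma Lnorm_le_mean_power (E : R * R -> R) (p M : R) (K N : nat) :
  1 <= p -> p <= K%:R -> ~~ odd K -> 0 < M -> (0 < N)%N ->
  measurable_fun [set: R * R] E ->
  (forall x y, \sum_(m < N) E (x + m%:R / N%:R, y) ^+ K <= N%:R * M ^+ K) ->
  ('N[@lebesgue2 R]_p%:E[(EFin \o E) \_ Omega2] <= (2 * M)%:E)%E.
Proof.
move=> p1 pK eK M0 N0 mE hE.
have p0 : 0 < p := lt_le_trans ltr01 p1.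
have NR : 0 < N%:R :> R by rewrite ltr0n.
have Ni : 0 < N%:R^-1 :> R by rewrite invr_gt0.
have Mp0 : 0 <= M `^ p := powR_ge0 _ _.
pose g z := M `^ p * (1 + (E z / M) ^+ K).
have g0 z : 0 <= g z by rewrite mulr_ge0 // addr_ge0 // exprn_even_ge0.
have mg : measurable_fun [set: R * R] g.
  apply: measurable_funM => //; apply: measurable_funD => //.
  by apply: measurable_funX; exact: measurable_funM.
have inner y : (\int[mu]_(x in `[0%R, 1%R[) (g (x, y))%:E <= (2 * M `^ p)%:E)%E.
  have mgy : measurable_fun [set: R] (EFin \o (fun x => g (x, y))).
    by apply/measurable_EFinP; apply: (measurableT_comp mg); exact: pair2_measurable.
  have := ge0_integral_periods N Ni mgy (fun x => g0 (x, y)).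
  rewrite divff ?gt_eqF // => ->.
  apply: (@le_trans _ _ (\int[mu]_(x in `[0%R, N%:R^-1%R[) (2 * M `^ p * N%:R)%:E)%E).
    apply: ge0_le_integral => //.
    - by move=> x _; apply: sume_ge0 => i _; rewrite /= lee_fin.
    - apply: emeasurable_sum => i; apply: measurable_funTS.
      apply: (measurableT_comp mgy); exact: measurable_funD.
    move=> x _; rewrite /= sumEFin lee_fin.
    have -> : \sum_(i < N) g (x + i%:R / N%:R, y) =
        M `^ p * (N%:R + (\sum_(i < N) E (x + i%:R / N%:R, y) ^+ K) / M ^+ K).
      rewrite /g -mulr_sumr big_split /= sumr_const card_ord; congr (_ * (_ + _)).
      by rewrite mulr_suml; apply: eq_bigr => i _; rewrite expr_div_n.
    have -> : 2 * M `^ p * N%:R = M `^ p * (N%:R + N%:R) by ring.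
    by rewrite ler_wpM2l // lerD2l ler_pdivrMr ?exprn_gt0.
  have mi : mu `[0%R, N%:R^-1%R[%classic = (N%:R^-1)%:E.
    by rewrite lebesgue_measure_itv /= lte_fin Ni -EFinD subr0.
  by rewrite integral_cst //= mi -EFinM mulfK // gt_eqF.
have mO : measurable (@Omega2 R) by apply: measurableX; exact: measurable_itv.
have key : (\int[@lebesgue2 R]_z (`|((EFin \o E) \_ Omega2) z| `^ p) <= (2 * M `^ p)%:E)%E.
  pose G z := g z * \1_(`[0, 1[%classic : set R) z.1 * \1_(`[0, 1[%classic : set R) z.2.
  have G0 z : 0 <= G z by apply: mulr_ge0; [apply: mulr_ge0 => //|]; rewrite indicE.
  have mG : measurable_fun [set: R * R] G.
    have mI : measurable_fun [set: R] (\1_(`[0, 1[%classic : set R) : R -> R).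
      exact: measurable_indic.
    apply: measurable_funM; first (apply: measurable_funM => //).
      exact: measurableT_comp mI measurable_fst.
    exact: measurableT_comp mI measurable_snd.
  apply: (@le_trans _ _ (\int[@lebesgue2 R]_z (G z)%:E)%E).
    apply: ge0_le_integral => //.
    - by move=> z _; exact: poweR_ge0.
    - rewrite (_ : (fun z => (`|((EFin \o E) \_ Omega2) z| `^ p)%E) =
        (fun z => (`|(E \_ Omega2) z| `^ p)%:E)); last first.
        by apply/funext => z; rewrite !patchE; case: ifP.
      apply/measurable_EFinP; apply: (measurableT_comp (measurable_powR p)).
      apply: measurableT_comp => //; apply: (iffLR (measurable_restrictT E mO)).
      exact: measurable_funTS.
    - exact/measurable_EFinP.
    move=> -[x y] _; rewrite patchE /G !indicE /=.
    have -> : ((x, y) \in Omega2) = (x \in `[0, 1[%classic) && (y \in `[0, 1[%classic).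
      by rewrite in_setX.
    case: (x \in _); case: (y \in _);
      rewrite /= ?mulr1 ?mulr0 ?mul0r ?lee_fin ?normr0 ?powR0 ?gt_eqF //.
    by apply: powR_le_even_power => //; exact: ltW.
  rewrite /lebesgue2 fubini_tonelli2 /=; last 2 first.
  - exact/measurable_EFinP.
  - by move=> z; rewrite lee_fin.
  have m1 : mu `[0%R, 1%R[%classic = 1%E.
    by rewrite lebesgue_measure_itv /= lte_fin ltr01 -EFinD subr0.
  apply: (@le_trans _ _ (\int[mu]_(y in `[0%R, 1%R[) (2 * M `^ p)%:E)%E); last first.
    by rewrite integral_cst //= m1 mule1.
  rewrite [leRHS]integral_mkcond.
  apply: ge0_le_integral => //.
  - by move=> y _; apply: integral_ge0 => x _; rewrite lee_fin.
  - apply: measurable_fun_fubini_tonelli_G; last by move=> z; rewrite lee_fin.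
    exact/measurable_EFinP.
  - by apply: (iffLR (measurable_restrictT (cst _) (measurable_itv _))).
  move=> y _; rewrite patchE /fubini_G /G /=; case: ifPn => hy.
    apply: le_trans (inner y); rewrite [leRHS]integral_mkcond le_eqVlt.
    apply/orP; left; apply/eqP; apply: eq_integral => x _.
    rewrite patchE !indicE hy mulr1; case: ifP; rewrite ?mulr1 ?mulr0 //.
  by rewrite indicE (negbTE hy); under eq_integral do rewrite mulr0; rewrite integral0.
rewrite unlock /Lnorm.
apply: (@le_trans _ _ ((2 * M `^ p)%:E `^ p^-1)%E).
  apply: gt0_ler_poweR => //; first by rewrite invr_ge0 ltW.
  - by rewrite in_itv /= leey andbT; apply: integral_ge0 => z _; exact: poweR_ge0.
  - by rewrite in_itv /= leey andbT lee_fin mulr_ge0.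
rewrite poweR_EFin lee_fin powRM // -powRrM divff ?gt_eqF // powRr1 ?(ltW M0) //.
by rewrite ler_wpM2r ?(ltW M0) // ler1_powR ?ler1n // invf_le1.
Qed.

End LpNorm.

Section SmoothError.
Variable R : realType.

Lemma measurable_smooth_error (r m : nat) (xi : 'I_m -> R * R) (a u : R * R) :
  0 < u.1 -> 0 < u.2 -> measurable_fun [set: R * R] (smooth_error r.+1 xi a u).
Proof.
move=> u1 u2.
rewrite (_ : smooth_error _ _ _ _ = fun z => u.1 ^+ r.+1 * u.2 ^+ r.+1 -
    m%:R^-1 * \sum_(i < m) (per_spline r u.1 ((xi i).1 - a.1 - z.1) *
                            per_spline r u.2 ((xi i).2 - a.2 - z.2))); last first.
  apply/funext => z; rewrite /smooth_error integral_periodized_hbox //.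
  congr (_ - _ * _); apply: eq_bigr => i _.
  by rewrite periodized_hboxE // [X in per_spline r u.1 X]addrAC [X in per_spline r u.2 X]addrAC.
have mB (v c : R) : measurable_fun [set: R] (fun x => per_spline r v (c - x)).
  by apply: (measurableT_comp (measurable_per_spline r v)); exact: measurable_funB.
apply: measurable_funB => //; apply: measurable_funM => //.
apply: measurable_sum => i; apply: measurable_funM.
  exact: (measurableT_comp (mB u.1 _) measurable_fst).
exact: (measurableT_comp (mB u.2 _) measurable_snd).
Qed.

(** A side longer than 1 would contain two points at distance 1, which [0, 1) does not. *)
Lemma box_scale_le1 (r : nat) (a u : R * R) : (0 < r)%N -> 0 < u.1 -> 0 < u.2 ->
  box r a u `<=` Omega2 -> r%:R * u.1 <= 1 /\ r%:R * u.2 <= 1.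
Proof.
move=> r0 u1 u2 sub; have rR : 0 < r%:R :> R by rewrite ltr0n.
have s1 : 0 < r%:R * u.1 by apply: mulr_gt0.
have s2 : 0 < r%:R * u.2 by apply: mulr_gt0.
have corner x y : a.1 - r%:R * u.1 / 2 <= x < a.1 + r%:R * u.1 / 2 ->
    a.2 - r%:R * u.2 / 2 <= y < a.2 + r%:R * u.2 / 2 -> (0 <= x < 1) /\ (0 <= y < 1).
  by move=> hx hy; have := sub (x, y); rewrite /box /Omega2 /= !in_itv /= => /(_ (conj hx hy)).
have low (x s : R) : 0 < s -> x - s / 2 <= x - s / 2 < x + s / 2 by move=> ?; lra.
have high (x s : R) : 1 < s -> x - s / 2 <= x - s / 2 + 1 < x + s / 2 by move=> ?; lra.
have [/andP[l1 _] /andP[l2 _]] := corner _ _ (low a.1 _ s1) (low a.2 _ s2).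
split; rewrite leNgt; apply/negP => h.
- by have [/andP[_ h1] _] := corner _ _ (high a.1 _ h) (low a.2 _ s2); lra.
- by have [_ /andP[_ h2]] := corner _ _ (low a.1 _ s1) (high a.2 _ h); lra.
Qed.

Lemma smooth_error_Lnorm (r n q : nat) (a u : R * R) (p L : R) :
  (0 < n)%N -> 0 < u.1 <= 1 -> 0 < u.2 <= 1 -> let N := fibn n in
  1 <= u.1 * u.2 * N%:R -> 1 <= L -> ln (u.1 * u.2 * N%:R) <= L ->
  1 <= p -> p <= (2 * q.+1)%:R ->
  ('N[@lebesgue2 R]_p%:E[(EFin \o smooth_error r.+1 (@fibonacci_set R n) a u) \_ Omega2]
   <= (2 * (lattice_error_const q r (sample_const R r) * Num.sqrt L / N%:R ^+ r.+1))%:E)%E.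
Proof.
move=> n0 hu1 hu2 N uN L1 hL p1 pq.
have N0 : (0 < N)%N := fibn_gt0 n.
have NX : 0 < N%:R ^+ r.+1 :> R by rewrite exprn_gt0 // ltr0n.
have B0 := sample_const_gt0 R r.
have K0 := lattice_error_const_gt0 q r B0.
apply: (@Lnorm_le_mean_power R _ p _ (2 * q.+1) N) => //.
- by rewrite mul2n odd_double.
- apply: divr_gt0 => //; apply: mulr_gt0 => //.
  by rewrite sqrtr_gt0 (lt_le_trans ltr01).
- by apply: measurable_smooth_error; [case/andP: hu1|case/andP: hu2].
- move=> x y; exact: smooth_error_mean_power.
Qed.

End SmoothError.

Theorem theorem1p2 (R : realType) (r : nat) (p : R)
  (hr : (1 <= r)%N) (hp : 1 <= p) :
  exists c C : R, 0 < c /\ 0 < C /\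
    forall (n : nat) (v : R), (1 <= n)%N -> 0 < v -> v <= 1 ->
      c / (fibn n)%:R <= v ->
      (periodic_discrepancy r p%:E (fibonacci_set R n) v
        <= (C * (Num.sqrt (ln ((fibn n)%:R * v)) / (fibn n)%:R ^+ r))%:E)%E.
Proof.
(* Then p < q + 1 <= 2 (q + 1), the even exponent of the moments. *)
case: r hr => // r _; set q := Num.truncn p.
have rR : 0 < r.+1%:R :> R by rewrite ltr0n.
have B0 := sample_const_gt0 R r.
have K0 := lattice_error_const_gt0 q r B0.
have pq : p <= (2 * q.+1)%:R.
  by rewrite natrM (le_trans (ltW (truncnS_gt p))) // ler_peMl // ler1n.
(* Since N v = r^2 N u_1 u_2 for the smoothness r, here [r.+1], this c gives N u_1 u_2 >= e, so L =
   ln (N v) is at least 1 and absorbs the bounded terms. *)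
exists (r.+1%:R ^+ 2 * expR 1), (2 * lattice_error_const q r (sample_const R r)).
split; first by rewrite mulr_gt0 ?exprn_gt0 ?expR_gt0.
split; first by rewrite mulr_gt0.
move=> n v n1 v0 v1 hv.
have NR : 0 < (fibn n)%:R :> R by rewrite ltr0n fibn_gt0.
rewrite ler_pdivrMr // in hv.
apply: ge_ereal_sup => _ [a [u [u1 u2 sub vol ->]]].
have [b1 b2] := box_scale_le1 (ltn0Sn r) u1 u2 sub.
have le1 x : 0 < x -> r.+1%:R * x <= 1 -> x <= 1.
  by move=> x0; apply: le_trans; rewrite ler_peMl ?(ltW x0) // ler1n.
have nv : (fibn n)%:R * v = r.+1%:R ^+ 2 * (u.1 * u.2 * (fibn n)%:R).
  by rewrite -vol /box_vol; ring.
have r21 : 1 <= r.+1%:R ^+ 2 :> R by rewrite exprn_ege1 // ler1n.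
have r20 : 0 < r.+1%:R ^+ 2 :> R := lt_le_trans ltr01 r21.
have e1 : expR 1 <= u.1 * u.2 * (fibn n)%:R.
  by rewrite -(ler_pM2l r20) -nv [leRHS]mulrC.
have e2 : u.1 * u.2 * (fibn n)%:R <= (fibn n)%:R * v.
  by rewrite nv ler_peMl // (le_trans _ e1) // expR_ge0.
have u0 : 0 < u.1 * u.2 * (fibn n)%:R by rewrite (lt_le_trans (expR_gt0 1)).
have -> : 2 * lattice_error_const q r (sample_const R r) *
    (Num.sqrt (ln ((fibn n)%:R * v)) / (fibn n)%:R ^+ r.+1) =
  2 * (lattice_error_const q r (sample_const R r) *
    Num.sqrt (ln ((fibn n)%:R * v)) / (fibn n)%:R ^+ r.+1) by rewrite !mulrA.
apply: smooth_error_Lnorm => //.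
- by rewrite u1 le1.
- by rewrite u2 le1.
- by rewrite (le_trans _ e1) // -[leLHS]expR0 ler_expR.
- by rewrite -[leLHS]expRK ler_ln ?posrE ?expR_gt0 ?(lt_le_trans u0) // (le_trans e1).
- by rewrite ler_ln ?posrE // (lt_le_trans u0).
Qed.
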